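(* Assume: (UM) the potential $V$ has a unique minimum; (MT) $t^N_{\mathrm{mix}}(1/4)/N^a\to0$ as $N\to\infty$, for some $a>0$; (SLDP) the sequence $\{\mathcal P_N\}_N$ of probability measures on $\mathcal M_+$ satisfies a large deviation principle with speed $N$ and rate function $V_*$, i.e. for each closed $\mathcal K\subset\mathcal M_+$ and each open $\mathcal U\subset\mathcal M_+$, $$\limsup_{N\to\infty}\frac1N\log\mathcal P_N(\mathcal K)\le-\inf_{\varrho\in\mathcal K}V_*(\varrho),\qquad \liminf_{N\to\infty}\frac1N\log\mathcal P_N(\mathcal U)\ge-\inf_{\varrho\in\mathcal U}V_*(\varrho).$$ Let $\mathcal O\subset\mathcal M_+$ be an open set with $\mathcal O\cap\mathcal M_{+,1}\ne\emptyset$ and $d(\bar\varrho_*,\mathcal O)=\inf_{\varrho\in\mathcal O}d(\bar\varrho_*,\varrho)>0$, and let $H_N^{\mathcal O}=\inf\{t\ge0:\eta^N_t\in\mathcal O^N\}$. Then, for any sequence $\eta^N\in\mathcal A_*^N$, the random variable $H_N^{\mathcal O}/\mathbb E_{\mu_N}[H_N^{\mathcal O}]$ under $\mathbb P_{\eta^N}$ converges in distribution, as $N\to\infty$, to a mean one exponential random variable.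
   Context: **Microscopic model.** For $N\ge1$ let $\mathbb T_N=\mathbb Z/N\mathbb Z$ and $X_N=\{0,1\}^{\mathbb T_N}$. For $\eta\in X_N$, $\eta^{x,y}$ is $\eta$ with the values at $x,y$ exchanged and $\eta^x$ is $\eta$ with the value at $x$ replaced by $1-\eta(x)$. Fix a strictly positive local function $c:\{0,1\}^{\mathbb Z}\to(0,\infty)$ (it depends on finitely many coordinates, so it is identified with a function on $X_N$ for $N$ large) and set $c(x,\eta)=c(\eta(\cdot+x))$ (sums modulo $N$). The reaction–diffusion model is the continuous-time Markov process $\{\eta^N_t:t\ge0\}$ on $X_N$ with generator $$L_Nf(\eta)=\sum_{x\in\mathbb T_N}c(x,\eta)[f(\eta^x)-f(\eta)]+\frac{N^2}{2}\sum_{x\in\mathbb T_N}[f(\eta^{x,x+1})-f(\eta)].$$ It is irreducible; $\mu_N$ is its unique stationary probability measure. $\mathbb P_\eta$ is the law of the process started from $\eta$; $\mathbb E_{\mu_N}$ is expectation for the process started from the distribution $\mu_N$. With $\|\mu-\nu\|_{TV}=\max_{A\subset X_N}|\mu(A)-\nu(A)|$, $$t^N_{\mathrm{mix}}(\varepsilon)=\inf\{t\ge0:\max_{\eta\in X_N}\|\mathbb P_\eta(\eta^N_t\in\cdot)-\mu_N(\cdot)\|_{TV}\le\varepsilon\}.$$ **Potential.** With $\nu_\rho$ the Bernoulli product measure of density $\rho\in[0,1]$, let $B(\rho)=\int[1-\eta(0)]c(0,\eta)\,d\nu_\rho$, $D(\rho)=\int\eta(0)c(0,\eta)\,d\nu_\rho$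 (polynomials on $[0,1]$), $F=B-D$, and let $V$ (the potential) be a primitive of $-F$. ''Unique minimum'' means exactly one local minimum (as opposed to the case of $\ell\ge2$ local minima); $\rho_*$ denotes the point at which it is attained, $\bar\rho_*\equiv\rho_*$ on $\mathbb T$ and $\bar\varrho_*(d\theta)=\rho_*\,d\theta$. **Space of measures.** Let $\mathbb T=\mathbb R/\mathbb Z$ and let $\mathcal M_+$ be the set of nonnegative measures on $\mathbb T$ with total mass at most $1$, with the weak topology, metrized by $d(\varrho_1,\varrho_2)=\sum_{k\in\mathbb Z}2^{-|k|}|\langle\varrho_1,e_k\rangle-\langle\varrho_2,e_k\rangle|$, where $\langle\varrho,G\rangle=\int G\,d\varrho$, $e_0=1$, $e_k(\theta)=\sqrt2\cos(2\pi k\theta)$, $e_{-k}(\theta)=\sqrt2\sin(2\pi k\theta)$ for $k\ge1$. $\mathcal B(\alpha;\varrho)$ is the open $\alpha$-neighborhood of $\varrho$. $\mathcal M_{+,1}\subset\mathcal M_+$ is the set of measures $\rho(\theta)d\theta$ with $0\le\rho\le1$ a.e. The empirical measure is $\pi_N(\eta)=\frac1N\sum_{x\in\mathbb T_N}\eta(x)\delta_{x/N}$; $\mathcal P_N=\mu_N\circ\pi_N^{-1}$; and for $\mathcal D\subset\mathcal M_+$, $\mathcal D^N=\pi_N^{-1}(\mathcal D)\subset X_N$. **Dynamical rate function.** $D([0,T],X)$ is the space of right-continuous trajectories with left limits. $C^{m,n}([0,T]\times\mathbb T)$ is the set of real functions $m$ times differentiable in time and $n$ times in space with continuous derivatives.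 For $\pi(t,d\theta)=\rho(t,\theta)d\theta$ in $D([0,T],\mathcal M_{+,1})$ put $$\mathcal E_T(\pi)=\sup_{G\in C^{0,1}}\Big\{2\int_0^T\langle\rho_t,\nabla G_t\rangle dt-\int_0^T\!\!\int_{\mathbb T}G(t,\theta)^2d\theta dt\Big\},$$ and, with $\chi(r)=r(1-r)$, for $G\in C^{1,2}$, $$\bar J_{T,G}(\pi)=\langle\pi_T,G_T\rangle-\langle\pi_0,G_0\rangle-\int_0^T\langle\pi_t,\partial_tG_t+\tfrac12\Delta G_t\rangle dt-\tfrac12\int_0^T\langle\chi(\rho_t),(\nabla G_t)^2\rangle dt-\int_0^T\{\langle B(\rho_t),e^{G_t}-1\rangle+\langle D(\rho_t),e^{-G_t}-1\rangle\}dt.$$ Set $I_T(\pi)=\sup_{G\in C^{1,2}}\bar J_{T,G}(\pi)$ if $\pi\in D([0,T],\mathcal M_{+,1})$ and $\mathcal E_T(\pi)<\infty$, and $I_T(\pi)=\infty$ for all other $\pi\in D([0,T],\mathcal M_+)$. For measurable $\rho:\mathbb T\to[0,1]$, $I_T(\pi|\rho)=I_T(\pi)$ if $\pi(0,d\theta)=\rho(\theta)d\theta$, and $=\infty$ otherwise. Define $$V_*(\varrho)=\inf\{I_T(\pi|\bar\rho_* ):T>0,\ \pi\in D([0,T],\mathcal M_+),\ \pi_T=\varrho\},\qquad\varrho\in\mathcal M_+.$$ **The set $\mathcal A_*$.** Let $\gamma_*=d(\bar\varrho_*,\mathcal O)$, $\mathcal C_*=\mathcal B(\gamma_*;\bar\varrho_*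 )$ and $2h_*=\inf\{V_*(\varrho):\varrho\notin\mathcal C_*\}$, which is $>0$. The constant $\alpha_*\in(0,\gamma_* )$ is fixed so that, with $\mathcal A_*=\mathcal B(\alpha_*;\bar\varrho_* )$, $$\lim_{N\to\infty}\max_{\eta^N\in\mathcal A_*^N}\mathbb P_{\eta^N}\big(H_N^{\mathcal O}\le e^{Nh_*}\big)=0$$ (such an $\alpha_*$ exists). *)

(* Defs.v *)
From HB Require Import structures.
From mathcomp Require Import all_boot all_order all_algebra fingroup.perm.
From mathcomp Require Import all_classical all_reals all_analysis.
Set Implicit Arguments.
Unset Strict Implicit.
Unset Printing Implicit Defensive.
Import Order.TTheory GRing.Theory Num.Theory.
Import numFieldNormedType.Exports.
Local Open Scope classical_set_scope.
Local Open Scope ring_scope.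

(* The torus R/Z is represented by its fundamental domain [0, 1[: a measure on
   the torus is a Borel measure on R that vanishes outside [0, 1[, and a
   function on the torus is a 1-periodic function on R. *)
Record Mplus (R : realType) := MkMplus {
  mplus_measure :> {measure set (measurableTypeR R) -> \bar R};
  mplus_mass : (mplus_measure setT <= 1)%E;
  mplus_torus : (mplus_measure (~` `[0%R, 1%R[) = 0)%E }.

(* A bundled measure also assigns junk values to nonmeasurable sets, so that
   equality of measures is tested on measurable sets only. *)
Definition same_measure (R : realType) (m1 m2 : Mplus R) : Prop :=
  forall A : set (measurableTypeR R), measurable A -> m1 A = m2 A.

Definition pairing (R : realType) (m : Mplus R) (G : R -> R) : R :=
  \int[m]_x G x.

(* Negz k stands for - k.+1. *)
Definition fourier (R : realType) (k : int) (x : R) : R :=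
  match k with
  | Posz 0 => 1
  | Posz k => Num.sqrt 2 * cos (2 * pi * k%:R * x)
  | Negz k => Num.sqrt 2 * sin (2 * pi * k.+1%:R * x)
  end.

(* The value is always finite; the extended reals only provide the sum over
   all integers as an unconditional sum of nonnegative terms. *)
Definition distM (R : realType) (m1 m2 : Mplus R) : \bar R :=
  \esum_(k in [set: int])
    (2 ^- `|k|%N * `|pairing m1 (fourier k) - pairing m2 (fourier k)|)%:E.

Section Mplus_topology.
Context {R : realType}.
Implicit Types m : Mplus R.

HB.instance Definition _ := gen_eqMixin (Mplus R).
HB.instance Definition _ := gen_choiceMixin (Mplus R).

Definition ballM m (e : R) : set (Mplus R) := [set m' | (distM m m' < e%:E)%E].

Let distM_term_ge0 m1 m2 k :
  (0 <= (2 ^- `|k|%N *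
    `|pairing m1 (fourier k) - pairing m2 (fourier k)| : R)%:E)%E.
Proof. by rewrite lee_fin mulr_ge0// invr_ge0 exprn_ge0. Qed.

Lemma ballM_center m (e : R) : 0 < e -> ballM m e m.
Proof.
move=> e0; rewrite /ballM/= /distM esum1 ?lte_fin// => k _.
by rewrite subrr normr0 mulr0.
Qed.

Lemma ballM_sym m1 m2 (e : R) : ballM m1 e m2 -> ballM m2 e m1.
Proof.
rewrite /ballM/= /distM; congr (_ < _)%E.
by apply: eq_esum => k _; rewrite distrC.
Qed.

Lemma ballM_triangle m1 m2 m3 (e1 e2 : R) :
  ballM m1 e1 m2 -> ballM m2 e2 m3 -> ballM m1 (e1 + e2) m3.
Proof.
rewrite /ballM/= => h1 h2; rewrite EFinD.
apply: le_lt_trans (lteD h1 h2).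
rewrite /distM -esumD; [|by move=> *; exact: distM_term_ge0..].
apply: le_esum => k _.
by rewrite -EFinD lee_fin -mulrDr ler_wpM2l ?invr_ge0 ?exprn_ge0// ler_distD.
Qed.

HB.instance Definition _ := hasNbhs.Build (Mplus R) (nbhs_ (entourage_ ballM)).
HB.instance Definition _ := Nbhs_isPseudoMetric.Build R (Mplus R)
  erefl ballM_center ballM_sym ballM_triangle erefl.

End Mplus_topology.

Definition is_density (R : realType) (m : Mplus R) (rho : R -> R) : Prop :=
  [/\ measurable_fun (`[0, 1[ : set (measurableTypeR R)) rho,
      {ae @lebesgue_measure R, forall x : R, x \in `[0, 1[ -> 0 <= rho x <= 1} &
      forall A : set (measurableTypeR R), measurable A ->
        m A = (\int[lebesgue_measure]_(x in A `&` `[0%R, 1%R[) (rho x)%:E)%E].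

Definition Mplus1 (R : realType) : set (Mplus R) :=
  [set m | exists rho, is_density m rho].

(* A density of m; everything below depends on it only up to null sets. *)
Definition density (R : realType) (m : Mplus R) : R -> R :=
  xget (fun=> 0) [set rho | is_density m rho].

Section constant_density.
Context {R : realType} (rho : {i01 R}).

Definition Mconst_measure : {measure set (measurableTypeR R) -> \bar R} :=
  mscale (rho%:num)%:nng
    (mrestr (@lebesgue_measure R) (measurable_itv `[0%R, 1%R[)).

Lemma Mconst_mass : (Mconst_measure setT <= 1)%E.
Proof.
rewrite /Mconst_measure/= /mscale/= /mrestr/= setTI lebesgue_measure_itv/=.
by rewrite lte01 oppr0 adde0 mule1 lee_fin.
Qed.

Lemma Mconst_torus : (Mconst_measure (~` `[0%R, 1%R[) = 0)%E.
Proof.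
by rewrite /Mconst_measure/= /mscale/= /mrestr/= setICl measure0 mule0.
Qed.

Definition Mconst : Mplus R := MkMplus Mconst_mass Mconst_torus.

End constant_density.

(* The discrete torus with N = n.+1 sites is 'I_n.+1, with its canonical
   additive group structure modulo n.+1. *)
Definition config (n : nat) := {ffun 'I_n.+1 -> bool}.

Definition flip n (eta : config n) (x : 'I_n.+1) : config n :=
  [ffun z => if z == x then ~~ eta z else eta z].

Definition swap n (eta : config n) (x y : 'I_n.+1) : config n :=
  [ffun z => eta (tperm x y z)].

Definition local_function (R : realType) (r : nat) (c : (int -> bool) -> R) :=
  forall eta xi : int -> bool,
    (forall z : int, (`|z| <= r)%N -> eta z = xi z) -> c eta = c xi.

(* A configuration on the discrete torus is read as a periodic one on the
   integers. *)
Definition rate (R : realType) (c : (int -> bool) -> R) n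
    (x : 'I_n.+1) (eta : config n) : R :=
  c (fun z : int => eta (x + Zp1 *~ z)).

Definition generator (R : realType) (c : (int -> bool) -> R) n
    (f : config n -> R) (eta : config n) : R :=
  \sum_(x : 'I_n.+1) rate c x eta * (f (flip eta x) - f eta) +
  n.+1%:R ^+ 2 / 2 *
    \sum_(x : 'I_n.+1) (f (swap eta x (x + Zp1)) - f eta).

Section empirical_measure.
Context {R : realType} (n : nat) (eta : config n).

Definition empirical_measure : {measure set (measurableTypeR R) -> \bar R} :=
  mscale (n.+1%:R^-1)%:nng
    (msum (fun k : nat => mscale ((eta (inord k))%:R)%:nng
                            \d_(k%:R / n.+1%:R : measurableTypeR R)) n.+1).

Lemma empirical_mass : (empirical_measure setT <= 1)%E.
Proof.
rewrite /empirical_measure/= /mscale/= /msum/=.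
under eq_bigr do rewrite /mscale/= diracT mule1.
rewrite sumEFin -EFinM lee_fin mulrC ler_pdivrMr// mul1r.
rewrite -[leRHS]mulr1 mulr_natl -[n.+1 in leRHS]card_ord -sumr_const.
by apply: ler_sum => i _; case: (eta _).
Qed.

Lemma empirical_torus : (empirical_measure (~` `[0%R, 1%R[) = 0)%E.
Proof.
rewrite /empirical_measure/= /mscale/= /msum/= big1 ?mule0// => i _.
rewrite /mscale/= diracE memNset ?mule0//=; apply.
by rewrite in_itv/= divr_ge0//= ltr_pdivrMr// mul1r ltr_nat.
Qed.

Definition empirical : Mplus R := MkMplus empirical_mass empirical_torus.

End empirical_measure.
Arguments empirical R {n} eta.

(* The path X is defined on one space Omega that carries the laws P eta of the
   process started from each state eta. *)
Record is_markov_process (R : realType) n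
    (L : (config n -> R) -> config n -> R) d (Omega : measurableType d)
    (P : config n -> probability Omega R) (X : R -> Omega -> config n) : Prop :=
  IsMarkovProcess {
  markov_measurable : forall t xi, 0 <= t -> measurable [set w | X t w = xi];
  markov_right : forall w t, 0 <= t -> \forall s \near t^'+, X s w = X t w;
  markov_left : forall w t, 0 < t ->
    exists xi, \forall s \near t^'-, X s w = xi;
  markov_start : forall eta, P eta [set w | X 0 w = eta] = 1%E;
  markov_property : forall eta xi zeta (h : seq (R * config n)) t s,
    0 <= t -> 0 <= s -> all (fun p => 0 <= p.1 <= t) h ->
    P eta [set w | [/\ all (fun p => X p.1 w == p.2) h, X t w = xi
                     & X (t + s) w = zeta]] =
    (P eta [set w | all (fun p => X p.1 w == p.2) h /\ X t w = xi] *
     P xi [set w | X s w = zeta])%E;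
  markov_generator : forall (f : config n -> R) eta,
    (\int[P eta]_w f (X t w) - f eta) / t @[t --> 0^'+] --> L f eta }.

Section process.
Context {R : realType} {n : nat} {d : measure_display}.
Context {Omega : measurableType d}.
Variables (P : config n -> probability Omega R) (X : R -> Omega -> config n).

Definition law (eta : config n) (t : R) (A : {set config n}) : R :=
  fine (P eta [set w | X t w \in A]).

Definition stationary (mu : config n -> R) : Prop :=
  [/\ forall eta, 0 <= mu eta, \sum_eta mu eta = 1 &
      forall t A, 0 <= t ->
        \sum_eta mu eta * law eta t A = \sum_(eta in A) mu eta].

Definition tv_distance (p q : {set config n} -> R) : R :=
  \big[Num.max/0]_(A : {set config n}) `|p A - q A|.

Definition mixing_time (mu : config n -> R) (e : R) : \bar R :=
  ereal_inf [set t%:E | t in [set t : R | 0 <= t /\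
    \big[Num.max/0]_(eta : config n)
      tv_distance (law eta t) (fun A => \sum_(xi in A) mu xi) <= e]].

Definition hitting_time (O : set (Mplus R)) (w : Omega) : \bar R :=
  ereal_inf [set t%:E | t in [set t : R | 0 <= t /\ O (empirical R (X t w))]].

Definition stationary_mean (mu : config n -> R) (H : Omega -> \bar R) : \bar R :=
  (\sum_(eta : config n) (mu eta)%:E * \int[P eta]_w H w)%E.

End process.

(* The integral, against the Bernoulli product measure, of a function that
   depends only on the coordinates in [-r, r]. *)
Definition window (r : nat) (s : {ffun 'I_(r.*2.+1) -> bool}) (z : int) : bool :=
  [exists i : 'I_(r.*2.+1), (i%:Z - r%:Z == z) && s i].

Definition bernoulli_mean (R : realType) (r : nat) (rho : R)
    (f : (int -> bool) -> R) : R :=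
  \sum_(s : {ffun 'I_(r.*2.+1) -> bool})
    (\prod_i (if s i then rho else 1 - rho)) * f (window s).

Definition birth (R : realType) r (c : (int -> bool) -> R) (rho : R) : R :=
  bernoulli_mean r rho (fun eta => (1 - (eta 0)%:R) * c eta).

Definition death (R : realType) r (c : (int -> bool) -> R) (rho : R) : R :=
  bernoulli_mean r rho (fun eta => (eta 0)%:R * c eta).

Definition is_potential (R : realType) r (c : (int -> bool) -> R) (V : R -> R) :=
  {within `[0, 1], continuous V} /\
  forall x : R, 0 < x < 1 -> is_derive x 1 V (- (birth r c x - death r c x)).

Definition local_min01 (R : realType) (V : R -> R) (x : R) : Prop :=
  0 <= x <= 1 /\
  exists2 e : R, 0 < e &
    forall y, 0 <= y <= 1 -> `|y - x| < e -> V x <= V y.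

Definition cadlag (R : realType) (E : topologicalType) (S : set E) (T : R)
    (u : R -> E) : Prop :=
  [/\ forall t, 0 <= t <= T -> S (u t),
      forall t, 0 <= t < T -> u s @[s --> t^'+] --> u t &
      forall t, 0 < t <= T -> exists2 l, S l & u s @[s --> t^'-] --> l].

Definition class_C01 (R : realType) (T : R) (G : R -> R -> R) : Prop :=
  [/\ forall t x, 0 <= t <= T -> G t (x + 1) = G t x,
      {within `[0, T] `*` [set: R], continuous (fun p : R * R => G p.1 p.2)},
      forall t x, 0 <= t <= T -> derivable (G t) x 1 &
      {within `[0, T] `*` [set: R],
        continuous (fun p : R * R => derive1 (G p.1) p.2)}].

(* The time derivative exists on ]0, T[ and extends continuously to [0, T]. *)
Definition class_C12 (R : realType) (T : R) (G : R -> R -> R) : Prop :=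
  [/\ class_C01 T G,
      forall t x, 0 <= t <= T -> derivable (derive1 (G t)) x 1,
      {within `[0, T] `*` [set: R],
        continuous (fun p : R * R => derive1 (derive1 (G p.1)) p.2)},
      forall t x, 0 < t < T -> derivable (G ^~ x) t 1 &
      exists2 dG : R -> R -> R,
        {within `[0, T] `*` [set: R], continuous (fun p : R * R => dG p.1 p.2)} &
        forall t x, 0 < t < T -> dG t x = derive1 (G ^~ x) t].

Section rate_function.
Context {R : realType}.
Local Notation leb := (@lebesgue_measure R).

Definition energy (T : R) (u : R -> Mplus R) : \bar R :=
  ereal_sup [set
    (2 * (\int[leb]_(t in `[0, T])
            \int[leb]_(x in `[0, 1[) (density (u t) x * derive1 (G t) x)) -
     \int[leb]_(t in `[0, T]) \int[leb]_(x in `[0, 1[) (G t x ^+ 2))%:E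
    | G in class_C01 T].

Variables (r : nat) (c : (int -> bool) -> R).

Definition J (T : R) (G : R -> R -> R) (u : R -> Mplus R) : R :=
  pairing (u T) (G T) - pairing (u 0) (G 0)
  - \int[leb]_(t in `[0, T])
      pairing (u t) (fun x => derive1 (G ^~ x) t + 2^-1 * derive1 (derive1 (G t)) x)
  - 2^-1 * \int[leb]_(t in `[0, T]) \int[leb]_(x in `[0, 1[)
      (density (u t) x * (1 - density (u t) x) * derive1 (G t) x ^+ 2)
  - \int[leb]_(t in `[0, T])
      (\int[leb]_(x in `[0, 1[)
         (birth r c (density (u t) x) * (expR (G t x) - 1)) +
       \int[leb]_(x in `[0, 1[)
         (death r c (density (u t) x) * (expR (- G t x) - 1))).

Definition rate_I (T : R) (u : R -> Mplus R) : \bar R :=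
  if `[< cadlag (@Mplus1 R) T u /\ (energy T u < +oo)%E >]
  then ereal_sup [set (J T G u)%:E | G in class_C12 T] else +oo%E.

Definition rate_I_from (T : R) (u : R -> Mplus R) (rho : R -> R) : \bar R :=
  if `[< is_density (u 0) rho >] then rate_I T u else +oo%E.

Definition quasi_potential (rho : R -> R) (m : Mplus R) : \bar R :=
  ereal_inf [set I | exists T u,
    [/\ 0 < T, cadlag setT T u, same_measure (u T) m & I = rate_I_from T u rho]].

End rate_function.

Definition empirical_law (R : realType) n (mu : config n -> R)
    (K : set (Mplus R)) : R :=
  \sum_(eta : config n | empirical R eta \in K) mu eta.

Definition static_LDP (R : realType) (mu : forall n, config n -> R)
    (I : Mplus R -> \bar R) : Prop :=
  (forall K : set (Mplus R), closed K ->
    (limn_esup (fun n => (n.+1%:R^-1)%:E * lne (empirical_law (mu n) K)%:E)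
     <= - ereal_inf (I @` K))%E) /\
  (forall U : set (Mplus R), open U ->
    (- ereal_inf (I @` U) <=
     limn_einf (fun n => (n.+1%:R^-1)%:E * lne (empirical_law (mu n) U)%:E))%E).

Definition cvg_in_distribution (R : realType) (d : nat -> measure_display)
    (Omega : forall n, measurableType (d n))
    (P : forall n, probability (Omega n) R)
    (Y : forall n, Omega n -> \bar R) (nu : set R -> \bar R) : Prop :=
  forall x : R, {for x, continuous (fun y : R => nu `]-oo, y]%classic)} ->
    P n [set w | (Y n w <= x%:E)%E] @[n --> \oo] --> nu `]-oo, x]%classic.

Definition dist_to_set (R : realType) (m : Mplus R) (O : set (Mplus R)) :
  \bar R := ereal_inf [set distM m m' | m' in O].

Definition half_exit_cost (R : realType) (W : Mplus R -> \bar R)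
    (m : Mplus R) (g : \bar R) : \bar R :=
  ((2^-1)%:E * ereal_inf [set W m' | m' in ~` [set m' | (distM m m' < g)%E]])%E.

(* Main.v *)
Require Import Defs.
From HB Require Import structures.
From mathcomp Require Import all_boot all_order all_algebra.
From mathcomp Require Import all_classical all_reals all_analysis.
From mathcomp Require Import measurable_realfun.
From mathcomp Require Import ring lra.
Set Implicit Arguments.
Unset Strict Implicit.
Unset Printing Implicit Defensive.
Import Order.TTheory GRing.Theory Num.Theory.
Import numFieldNormedType.Exports.
Local Open Scope classical_set_scope.
Local Open Scope ring_scope.

(** Why the theorem holds: the hitting time forgets the past, because the time
    needed to see the target is exponentially large in the number of sites, whereas
    the time needed to mix is only polynomial.

    For a fixed number of sites, write [G z t] for the probability of not having
    hit the target at time [t] from [z], and [S j] for its stationary average at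
    time [j * T], where [T] is a long multiple of the mixing time. By the Markov
    property, not hitting before [(i + 1 + j) * T] means not hitting before [i * T],
    then mixing during [T], then not hitting during [j * T]. Hence [S (i + j + 1)]
    is [S i * S j] up to [S i] times the mixing error, and up to the probability
    [S i - S (i + 1)] of hitting during the mixing period
    ([average_survival_mul_le], [average_survival_mul_ge]). The first error is
    proportional to [S i] and the second one telescopes, so the relation can be
    summed over [i]: with [M] the sum of all the [S i], the tail
    [M - (S 0 + ... + S j)] is close to [M * S j] ([tail_series_near]). This is the
    discrete form of the differential equation of an exponential, and it yields
    that [S j] is close to [(M / (M + 1)) ^ (j + 1)] ([near_geometric]). The sum
    [M] is, up to one, the stationary mean of the hitting time in units of [T]
    ([stationary_mean_bounds]), so that [S] at [x] times the mean is close to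
    [exp (- x)], provided that [M] is large ([survival_near_exponential]).

    The same mixing argument compares any starting point [z] with equilibrium,
    with an error that is the probability of hitting before [T] from [z]. For the
    given initial configurations this probability is small even up to the
    exponential time [exp (N h)], and this also forces [M] to be at least of the
    order of [exp (N h) / T], which tends to infinity ([series_sampled_large]).

    Two facts make the stationary mean finite ([uniform_hitting]). The target
    contains configurations, because a density with values in [0, 1] can be rounded
    to a configuration at distance of order [1 / N] ([open_reachable]); and every
    configuration has positive stationary probability, because flips have positive
    rates ([invariant_gt0]).

    The postulated Markov property concerns finitely many times. It is extended to
    the event of staying outside the target during a whole interval by refining
    dyadic meshes, which detect every visit since paths are right-continuous
    ([aliveE], [markov_alive]). *)

(** * Finite Markov chains with killing *)

Section oscillation.
Context {R : realType} {E : finType}.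
Implicit Types (p : E -> E -> R) (nu f : E -> R).

(** Subtracting its minimum from [f] does not change the sum, since [nu] is
    balanced; after that only the positive part of [nu] contributes. *)
Lemma sum_balanced_le nu f (a b : R) :
  \sum_x nu x = 0 -> (forall A : {set E}, \sum_(x in A) nu x <= a) ->
  0 <= b -> (forall x y, f x - f y <= b) -> \sum_x nu x * f x <= a * b.
Proof.
move=> nu0 nua b0 fb.
have a0 : 0 <= a by have := nua finset.set0; rewrite big_set0.
have [x0 _|E0] := pickP (@predT E); last first.
  by rewrite big_pred0 ?mulr_ge0.
have [m _ mP] := @Order.TotalTheory.arg_minP _ R E x0 predT f erefl.
have -> : \sum_x nu x * f x = \sum_x nu x * (f x - f m).
  under [RHS]eq_bigr do rewrite mulrBr.
  by rewrite sumrB -mulr_suml nu0 mul0r subr0.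
apply: (@le_trans _ _ (\sum_(x in [set x | 0 < nu x]%SET) nu x * b)).
  rewrite [leLHS](bigID (fun x => x \in [set x | 0 < nu x]%SET))/=.
  rewrite -[leRHS]addr0 lerD//.
    by apply: ler_sum => x; rewrite inE => x0'; rewrite ler_wpM2l// ltW.
  apply: sumr_le0 => x; rewrite inE -leNgt => x0'.
  by rewrite mulr_le0_ge0// subr_ge0 mP.
by rewrite -mulr_suml ler_wpM2r.
Qed.

(** Dobrushin's contraction: the difference of two rows is a balanced weight,
    whose positive part has mass at most [a]. *)
Lemma osc_contract p f (a b : R) :
  (forall x, \sum_y p x y = 1) ->
  (forall x x' (A : {set E}), \sum_(y in A) p x y - \sum_(y in A) p x' y <= a) ->
  0 <= b -> (forall x y, f x - f y <= b) ->
  forall x x', \sum_y p x y * f y - \sum_y p x' y * f y <= a * b.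
Proof.
move=> p1 pa b0 fb x x'.
rewrite -sumrB; under eq_bigr do rewrite -mulrBl.
apply: sum_balanced_le => // [|A].
  by rewrite sumrB !p1 subrr.
by rewrite sumrB.
Qed.

End oscillation.

(** [Q t x y] is the weight of the paths from [x] to [y] of duration [t] that
    have not been killed; [p] is the semigroup without killing. *)
Record killed_semigroup (R : realType) (E : finType) (p Q : R -> E -> E -> R) :
    Prop := KilledSemigroup {
  killed_ge0 : forall t x y, 0 <= t -> 0 <= Q t x y;
  killed_le : forall t x y, 0 <= t -> Q t x y <= p t x y;
  semigroup_sum1 : forall t x, 0 <= t -> \sum_y p t x y = 1;
  semigroupD : forall s t x y, 0 <= s -> 0 <= t ->
    p (s + t) x y = \sum_z p s x z * p t z y;
  killedD : forall s t x y, 0 <= s -> 0 <= t ->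
    Q (s + t) x y = \sum_z Q s x z * Q t z y }.

Record invariant_proba (R : realType) (E : finType) (p : R -> E -> E -> R)
    (mu : E -> R) : Prop := InvariantProba {
  invariant_ge0 : forall x, 0 <= mu x;
  invariant_sum1 : \sum_x mu x = 1;
  invariantE : forall t y, 0 <= t -> \sum_x mu x * p t x y = mu y }.

Definition survival (R : realType) (E : finType) (Q : R -> E -> E -> R) t x :=
  \sum_y Q t x y.

Definition average (R : realType) (E : finType) (mu f : E -> R) :=
  \sum_x mu x * f x.

Section killed.
Context {R : realType} {E : finType} {p Q : R -> E -> E -> R} {mu : E -> R}.
Hypotheses (pQ : killed_semigroup p Q) (pmu : invariant_proba p mu).
Local Notation G := (survival Q).
Implicit Types (s t T : R) (x y : E).

Lemma semigroup_ge0 t x y : 0 <= t -> 0 <= p t x y.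
Proof. by move=> t0; apply: le_trans (killed_le pQ x y t0); exact: (killed_ge0 pQ). Qed.

Lemma survival_ge0 t x : 0 <= t -> 0 <= G t x.
Proof. by move=> t0; apply: sumr_ge0 => y _; exact: (killed_ge0 pQ). Qed.

Lemma survival_le1 t x : 0 <= t -> G t x <= 1.
Proof.
move=> t0; rewrite -(semigroup_sum1 pQ x t0).
by apply: ler_sum => y _; exact: (killed_le pQ).
Qed.

Lemma survival_markov s t x : 0 <= s -> 0 <= t ->
  G (s + t) x = \sum_y Q s x y * G t y.
Proof.
move=> s0 t0; rewrite /survival.
under eq_bigr do rewrite (killedD pQ)//.
by rewrite exchange_big/=; apply: eq_bigr => z _; rewrite mulr_sumr.
Qed.

Lemma survival_anti s t x : 0 <= s -> s <= t -> G t x <= G s x.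
Proof.
move=> s0 st; rewrite -(subrK s t) addrC survival_markov ?subr_ge0//.
apply: ler_sum => y _; rewrite ler_piMr ?(killed_ge0 pQ)//.
by rewrite survival_le1 ?subr_ge0.
Qed.

Lemma survival_le_free T t x : 0 <= T -> 0 <= t ->
  G (T + t) x <= \sum_y p T x y * G t y.
Proof.
move=> T0 t0; rewrite survival_markov//; apply: ler_sum => y _.
by rewrite ler_wpM2r ?survival_ge0// (killed_le pQ).
Qed.

(** Forgetting the killing before [T] adds only paths killed before [T]. *)
Lemma survival_ge_free T t x : 0 <= T -> 0 <= t ->
  \sum_y p T x y * G t y - (1 - G T x) <= G (T + t) x.
Proof.
move=> T0 t0; rewrite survival_markov// lerBlDr -lerBlDl -sumrB.
rewrite -(semigroup_sum1 pQ x T0) -sumrB; apply: ler_sum => y _.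
by rewrite -mulrBl ler_piMr ?survival_le1// subr_ge0 (killed_le pQ).
Qed.

Local Notation Gmu t := (average mu (G t)).

Lemma average_survival_le1 t : 0 <= t -> Gmu t <= 1.
Proof.
move=> t0; rewrite -(invariant_sum1 pmu); apply: ler_sum => x _.
by rewrite ler_piMr ?(invariant_ge0 pmu)// survival_le1.
Qed.

Lemma average_survival_ge0 t : 0 <= t -> 0 <= Gmu t.
Proof.
move=> t0; apply: sumr_ge0 => x _.
by rewrite mulr_ge0 ?(invariant_ge0 pmu)// survival_ge0.
Qed.

Lemma average_survival_anti s t : 0 <= s -> s <= t -> Gmu t <= Gmu s.
Proof.
move=> s0 st; apply: ler_sum => x _.
by rewrite ler_wpM2l ?(invariant_ge0 pmu)// survival_anti.
Qed.

Lemma average_survival_markov s t : 0 <= s -> 0 <= t ->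
  Gmu (s + t) = \sum_y (\sum_x mu x * Q s x y) * G t y.
Proof.
move=> s0 t0; rewrite /average; under eq_bigr do rewrite survival_markov// mulr_sumr.
rewrite exchange_big/=; apply: eq_bigr => y _.
by rewrite mulr_suml; apply: eq_bigr => x _; rewrite mulrA.
Qed.

Lemma average_survivalE s : Gmu s = \sum_y \sum_x mu x * Q s x y.
Proof.
rewrite exchange_big; apply: eq_bigr => x _ /=.
by rewrite mulr_sumr.
Qed.

Section mixed.
Variables (T e : R).
Hypotheses (T0 : 0 <= T).
Hypothesis mix : forall (f : E -> R) x, (forall y, 0 <= f y <= 1) ->
  `|\sum_y p T x y * f y - average mu f| <= e.

Lemma survival_le_average t x : 0 <= t -> G (T + t) x <= Gmu t + e.
Proof.
move=> t0; apply: le_trans (survival_le_free x T0 t0) _.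
have := @mix (G t) x; rewrite ler_norml => /(_ _)/andP[|_].
  by move=> y; rewrite survival_ge0// survival_le1.
by rewrite lerBlDl.
Qed.

Lemma survival_ge_average t x : 0 <= t -> Gmu t - e - (1 - G T x) <= G (T + t) x.
Proof.
move=> t0; apply: le_trans (survival_ge_free x T0 t0); rewrite lerD2r.
have := @mix (G t) x; rewrite ler_norml => /(_ _)/andP[|+ _].
  by move=> y; rewrite survival_ge0// survival_le1.
lra.
Qed.

(** Conditioning at time [s] and then letting the chain mix during [T] makes
    the two survival probabilities nearly factorize; the multiplicative form of
    the error is what allows summation over [s]. *)
Lemma average_survival_mul_le s t : 0 <= s -> 0 <= t ->
  Gmu (s + (T + t)) <= Gmu s * (Gmu t + e).
Proof.
move=> s0 t0; rewrite average_survival_markov ?addr_ge0//.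
rewrite [X in X * _]average_survivalE mulr_suml.
apply: ler_sum => y _; rewrite ler_wpM2l ?survival_le_average//.
by apply: sumr_ge0 => x _; rewrite mulr_ge0 ?(invariant_ge0 pmu) ?(killed_ge0 pQ).
Qed.

(** The loss due to killing during the mixing period telescopes in [s]. *)
Lemma average_survival_mul_ge s t : 0 <= s -> 0 <= t ->
  Gmu s * (Gmu t - e) - (Gmu s - Gmu (s + T)) <= Gmu (s + (T + t)).
Proof.
move=> s0 t0; rewrite !(average_survival_markov s0) ?addr_ge0//.
rewrite [Gmu s]average_survivalE mulr_suml -!sumrB.
apply: ler_sum => y _; set W := \sum_x _.
have W0 : 0 <= W.
  by apply: sumr_ge0 => x _; rewrite mulr_ge0 ?(invariant_ge0 pmu) ?(killed_ge0 pQ).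
have := ler_wpM2l W0 (survival_ge_average y t0); lra.
Qed.

End mixed.

(** Halving the oscillation once per unit of time brings the chain
    exponentially close to equilibrium. *)
Lemma mixing_iter tau (k : nat) : 0 <= tau ->
  (forall x (A : {set E}), `|\sum_(y in A) p tau x y - \sum_(y in A) mu y| <= 4^-1) ->
  forall (f : E -> R) x, (forall y, 0 <= f y <= 1) ->
  `|\sum_y p (k%:R * tau) x y * f y - average mu f| <= 2^-1 ^+ k.
Proof.
move=> tau0 mix4 f x f01; have kt0 j : 0 <= j%:R * tau by rewrite mulr_ge0.
have osc j : forall x x', \sum_y p (j%:R * tau) x y * f y -
    \sum_y p (j%:R * tau) x' y * f y <= 2^-1 ^+ j.
  elim: j => [|j IH].
    move=> z z'; rewrite expr0.
    have S z1 : 0 <= \sum_y p (0%:R * tau) z1 y * f y <= 1.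
      rewrite sumr_ge0/=; last first.
        by move=> y _; rewrite mulr_ge0 ?semigroup_ge0//; case/andP: (f01 y).
      rewrite -[leRHS](semigroup_sum1 pQ z1 (kt0 0%N)); apply: ler_sum => y _.
      by rewrite ler_piMr ?semigroup_ge0//; case/andP: (f01 y).
    by have /andP[? ?] := S z; have /andP[? ?] := S z'; lra.
  have E1 z : \sum_y p (j.+1%:R * tau) z y * f y =
      \sum_y p tau z y * \sum_w p (j%:R * tau) y w * f w.
    rewrite mulrSr mulrDl mul1r addrC.
    under eq_bigr do rewrite (semigroupD pQ)// mulr_suml.
    rewrite exchange_big/=; apply: eq_bigr => y _.
    by rewrite mulr_sumr; apply: eq_bigr => w _; rewrite mulrA.
  move=> z z'; rewrite !E1 exprS; apply: osc_contract => //.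
    by move=> y; rewrite (semigroup_sum1 pQ).
  move=> y y' A; have := mix4 y A; have := mix4 y' A; rewrite !ler_norml; lra.
have -> : average mu f = \sum_z mu z * \sum_y p (k%:R * tau) z y * f y.
  under eq_bigr do rewrite mulr_sumr.
  rewrite exchange_big/=; apply: eq_bigr => y _.
  rewrite -{1}(invariantE pmu y (kt0 k)) mulr_suml.
  by apply: eq_bigr => z _; rewrite mulrA.
set g := fun z => \sum_y p (k%:R * tau) z y * f y.
have -> : g x - \sum_z mu z * g z = \sum_z mu z * (g x - g z).
  under [RHS]eq_bigr do rewrite mulrBr.
  by rewrite sumrB -mulr_suml (invariant_sum1 pmu) mul1r.
rewrite (le_trans (ler_norm_sum _ _ _))//.
apply: (@le_trans _ _ (\sum_z mu z * 2^-1 ^+ k)); last first.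
  by rewrite -mulr_suml (invariant_sum1 pmu) mul1r.
apply: ler_sum => z _.
rewrite normrM ger0_norm ?(invariant_ge0 pmu)// ler_wpM2l ?(invariant_ge0 pmu)//.
by rewrite ler_norml osc andbT lerNl opprB osc.
Qed.

End killed.

(** * Sequences that nearly factorize *)

Section near_exponential.
Context {R : realType} (S : nat -> R) (e : R).
Hypotheses (S_ge0 : forall i, 0 <= S i) (S_le1 : S 0%N <= 1).
Hypothesis S_anti : forall i, S i.+1 <= S i.

Lemma seriesSD (j n : nat) :
  series S (n + j)%N = series S j + \sum_(0 <= i < n) S (i + j)%N.
Proof.
elim: n => [|n IH]; first by rewrite big_nil addr0.
by rewrite addSn seriesSr IH big_nat_recr//= addrA.
Qed.

Let S_le1' i : S i <= 1.
Proof. by elim: i => [//|i]; exact/le_trans/S_anti. Qed.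

(** The sum of the first [n] terms is at most [k] plus [q] times itself. *)
Lemma cvg_series_decay (k : nat) (q : R) : q < 1 ->
  (forall i, S (i + k)%N <= q * S i) -> cvgn (series S).
Proof.
move=> q1 decay; have q1' : 0 < 1 - q by rewrite subr_gt0.
have nd : nondecreasing_seq (series S).
  by apply: nondecreasing_series => i _ _; exact: S_ge0.
apply: nondecreasing_is_cvgn => //; exists (k%:R / (1 - q)) => _ [n _ <-].
rewrite ler_pdivlMr// mulrBr mulr1 lerBlDr.
apply: (le_trans (nd n (n + k)%N (leq_addr _ _))).
rewrite seriesSD lerD//.
  rewrite /series/= -[leRHS]mul1r -[k in leRHS]subn0 mulr_natr -sumr_const_nat.
  exact: ler_sum.
by rewrite mulrC /series/= mulr_sumr ler_sum.
Qed.

Hypothesis S_mul_le : forall i j, S (i + j.+1)%N <= S i * (S j + e).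
Hypothesis S_mul_ge : forall i j,
  S i * (S j - e) - (S i - S i.+1) <= S (i + j.+1)%N.
Hypothesis S_cvg : cvgn (series S).
Local Notation M := (limn (series S)).
Hypothesis M_gt0 : 0 < M.

(** The bounds on [S (i + j.+1)] are linear in [S i] up to a telescoping term,
    so that they can be summed over [i]; what remains relates [S j] to the tail
    of the series after [j]. *)
Lemma tail_series_near j :
  `|M - series S j.+1 - M * S j| <= M * e + 1.
Proof.
have cvgS : series S n @[n --> \oo] --> M by exact: S_cvg.
have shift n : series S (n + j.+1)%N - series S j.+1 =
    \sum_(0 <= i < n) S (i + j.+1)%N by rewrite seriesSD addrAC subrr add0r.
have cvgT : series S (n + j.+1)%N - series S j.+1 @[n --> \oo]
    --> M - series S j.+1.
  by apply: cvgB; [rewrite (cvg_shiftn j.+1)|exact: cvg_cst].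
have up : M - series S j.+1 <= M * (S j + e).
  apply: (ler_cvg_to cvgT (cvgM cvgS (cvg_cst (S j + e)))).
  near=> n; change (series S (n + j.+1)%N - series S j.+1 <=
    series S n * (S j + e)).
  by rewrite shift /series/= mulr_suml ler_sum.
have lo : M * (S j - e) - 1 <= M - series S j.+1.
  have cvgL : series S n * (S j - e) - 1 @[n --> \oo] --> M * (S j - e) - 1.
    by apply: cvgB; [apply: cvgM => //|]; exact: cvg_cst.
  apply: (ler_cvg_to cvgL cvgT).
  near=> n; change (series S n * (S j - e) - 1 <=
    series S (n + j.+1)%N - series S j.+1).
  rewrite shift.
  apply: (@le_trans _ _ (series S n * (S j - e) - (S 0%N - S n))).
    by rewrite lerB// lerBlDr (le_trans S_le1)// lerDl S_ge0.
  have -> : S 0%N - S n = \sum_(0 <= i < n) (S i - S i.+1).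
    rewrite -[LHS]opprB -(telescope_sumr _ (leq0n n)) -sumrN.
    by apply: eq_bigr => i _; rewrite opprB.
  by rewrite /series/= mulr_suml -sumrB ler_sum.
by rewrite ler_norml; apply/andP; split; lra.
Unshelve. all: by end_near.
Qed.

(** The tail [M - series S j] satisfies, up to the error above, the recursion of
    a geometric sequence of ratio [M / (M + 1)], and its slope is [S j]. *)
Lemma near_geometric j :
  `|S j - (M / (M + 1)) ^+ j.+1| <= 2 * (e + M^-1).
Proof.
have M1 : 0 < M + 1 by rewrite addr_gt0.
set l := M / (M + 1); set d := M * e + 1.
have d0 : 0 <= d by apply: le_trans (tail_series_near 0); rewrite normr_ge0.
pose b i := M - series S i.
have bS i : `|b i.+1 - M * S i| <= d by exact: tail_series_near.
have bD i : S i = b i - b i.+1 by rewrite /b seriesSr; ring.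
have l0 : 0 <= l by rewrite divr_ge0// ltW.
have tail i : `|b i - M * l ^+ i| <= d.
  elim: i => [|i IH].
    by rewrite /b /series/= big_nil expr0 mulr1 subr0 subrr normr0.
  have E : (M + 1) * (b i.+1 - M * l ^+ i.+1) =
      (b i.+1 - M * S i) + M * (b i - M * l ^+ i).
    by rewrite exprS bD /l; field; rewrite gt_eqF.
  rewrite -(ler_pM2l M1) -[X in X * `|_|](gtr0_norm M1) -normrM E.
  apply: (le_trans (ler_normD _ _)); rewrite mulrDl mul1r addrC lerD//.
  by rewrite normrM gtr0_norm// ler_pM2l.
have Me : e + M^-1 = d / M by rewrite /d; field; rewrite gt_eqF.
rewrite Me mulrA ler_pdivlMr// -[X in _ * X](gtr0_norm M_gt0) -normrM.
have -> : (S j - l ^+ j.+1) * M =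
    (b j.+1 - M * l ^+ j.+1) - (b j.+1 - M * S j) by ring.
by rewrite (le_trans (ler_normB _ _))// mulr_natl mulr2n lerD.
Qed.

End near_exponential.

(** * Markov property for staying in a set of configurations *)

Section killed_process.
Context {R : realType} {n : nat} {L : (config n -> R) -> config n -> R}.
Context {d : measure_display} {Omega : measurableType d}.
Variables (P : config n -> probability Omega R) (X : R -> Omega -> config n).
Hypothesis XP : is_markov_process L P X.
Implicit Types (x y z : config n) (A : set Omega) (B : {set config n}) (s t u : R).
Implicit Types (l f : seq (R * {set config n})).

Definition prob x A : R := fine (P x A).

Lemma probE x A : measurable A -> P x A = (prob x A)%:E.
Proof. by move=> mA; rewrite /prob fineK// fin_num_measure. Qed.

Lemma prob_ge0 x A : 0 <= prob x A.
Proof. by rewrite /prob fine_ge0. Qed.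

Lemma prob_le x A A' : measurable A -> measurable A' -> A `<=` A' ->
  prob x A <= prob x A'.
Proof.
by move=> mA mA' AA'; rewrite -lee_fin -!probE// le_measure ?inE.
Qed.

Lemma prob_setI_sum1 x A A' : measurable A -> measurable A' ->
  prob x A' = 1 -> prob x (A' `&` A) = prob x A.
Proof.
move=> mA mA' A'1; apply/EFin_inj; rewrite -!probE//; last exact: measurableI.
rewrite -[in RHS](setIT A) -(setUv A') setIUr measureU//.
- rewrite setIC -[LHS]adde0; congr (_ + _)%E.
  apply/esym/eqP; rewrite eq_le measure_ge0 andbT.
  have <- : P x (~` A') = 0%E by rewrite probability_setC// probE// A'1 subee.
  by apply: le_measure; rewrite ?inE//; [apply: measurableI => //|]; exact: measurableC.
- exact: measurableI.
- by apply: measurableI => //; exact: measurableC.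
- by rewrite setIACA setICr setI0.
Qed.

Definition at_time t B : set Omega := [set w | X t w \in B].

Definition cylinder l : set Omega := [set w | all (fun q : R * {set config n} => X q.1 w \in q.2) l].

Lemma measurable_at_time t B : 0 <= t -> measurable (at_time t B).
Proof.
move=> t0; rewrite [at_time t B](_ : _ = \big[setU/set0]_(y in B) [set w | X t w = y]).
  by apply: bigsetU_measurable => y _; exact: (markov_measurable XP).
rewrite -bigcup_seq_cond; apply/seteqP; split => [w Bw|w [y /=]].
  by exists (X t w) => //=; rewrite mem_index_enum.
by move=> /andP[_ yB] Xy; rewrite /at_time/= Xy.
Qed.

Lemma cylinder_nil : cylinder [::] = setT.
Proof. by apply/seteqP; split. Qed.

Lemma cylinder_cons q l : cylinder (q :: l) = at_time q.1 q.2 `&` cylinder l.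
Proof. by apply/seteqP; split => w /=; [move=> /andP|move=> h; apply/andP]. Qed.

Lemma cylinder_cat l f : cylinder (l ++ f) = cylinder l `&` cylinder f.
Proof.
by apply/seteqP; split => w /=; rewrite /cylinder/= all_cat; [move=> /andP|move=> h; apply/andP].
Qed.

Lemma measurable_cylinder l : all (fun q => 0 <= q.1) l -> measurable (cylinder l).
Proof.
elim: l => [_|q l IH /= /andP[q0 l0]].
  by rewrite cylinder_nil.
by rewrite cylinder_cons; apply: measurableI; [exact: measurable_at_time|exact: IH].
Qed.

Lemma prob_at_time_sum x A t B : measurable A -> 0 <= t ->
  prob x (A `&` at_time t B) = \sum_(y in B) prob x (A `&` at_time t [set y]%SET).
Proof.
move=> mA t0; apply/EFin_inj.
have mE y : measurable (A `&` at_time t [set y]%SET).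
  by apply: measurableI => //; exact: measurable_at_time.
rewrite -probE; last by apply: measurableI => //; exact: measurable_at_time.
rewrite -sumEFin; under eq_bigr do rewrite -probE//.
rewrite -big_enum/= fsbig_seq ?enum_uniq// -measure_fin_bigcup//.
- congr (P x _); rewrite -setI_bigcupr; congr (_ `&` _).
  apply/seteqP; split => [w Bw|w [y /=]].
    by exists (X t w); rewrite /at_time/= ?mem_enum// inE.
  by rewrite mem_enum => yB; rewrite /at_time/= inE => /eqP ->.
- move=> y z _ _ [w [[_]]]; rewrite /at_time/= inE => /eqP <- [_].
  by move=> /set1P.
Qed.

Definition transition t x y : R := prob x (at_time t [set y]%SET).

(** The Markov property postulated for one future time, extended to histories
    that only restrict the past to sets. *)
Lemma markov_cylinder x l s z u y : all (fun q => 0 <= q.1 <= s) l ->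
  0 <= s -> 0 <= u ->
  prob x (cylinder l `&` at_time s [set z]%SET `&` at_time (s + u) [set y]%SET) =
  prob x (cylinder l `&` at_time s [set z]%SET) * transition u z y.
Proof.
move=> ls s0 u0.
have E v w : at_time v [set w]%SET = [set a | X v a = w].
  by apply/seteqP; split => a; rewrite /at_time/= inE => /eqP.
have mat v w : 0 <= v -> measurable (at_time v [set w]%SET).
  by move=> v0; exact: measurable_at_time.
have su0 : 0 <= s + u by rewrite addr_ge0.
have past (h : seq (R * config n)) : all (fun q => 0 <= q.1 <= s) h ->
    measurable [set w | all (fun q => X q.1 w == q.2) h].
  move=> hs; rewrite (_ : mkset _ = cylinder [seq (q.1, [set q.2]%SET) | q <- h]).
    apply: measurable_cylinder; rewrite all_map; apply: sub_all hs => q /=.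
    by move=> /andP[].
  by apply/seteqP; split => w; rewrite /cylinder/= all_map;
    apply: sub_all => q /=; rewrite inE.
suff H (h : seq (R * config n)) : all (fun q => 0 <= q.1 <= s) h ->
    prob x ([set w | all (fun q => X q.1 w == q.2) h] `&` cylinder l `&`
      at_time s [set z]%SET `&` at_time (s + u) [set y]%SET) =
    prob x ([set w | all (fun q => X q.1 w == q.2) h] `&` cylinder l `&`
      at_time s [set z]%SET) * transition u z y.
  by have := H [::] erefl; rewrite (_ : mkset _ = setT) ?setTI//;
     apply/seteqP; split.
elim: l ls h => [_ h hs|[v B] l IH /= /andP[/andP[v0 vs] ls] h hs].
  rewrite cylinder_nil setIT; apply: EFin_inj.
  rewrite EFinM -!probE; last 3 first.
  - exact: mat.
  - by apply: measurableI; [exact: past|exact: mat].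
  - by apply: measurableI; [apply: measurableI; [exact: past|exact: mat]|exact: mat].
  rewrite !E -(markov_property XP x z y s0 u0 hs).
  by congr (P x _); apply/seteqP; split => w /=; [move=> [[]]|move=> []].
have ml : measurable (cylinder l).
  by apply: measurable_cylinder; apply: sub_all ls => q /andP[].
have mh := past _ hs.
rewrite cylinder_cons /=.
have S A : measurable A ->
    prob x ([set w | all (fun q => X q.1 w == q.2) h] `&` (at_time v B `&` cylinder l)
      `&` A) =
    \sum_(b in B) prob x ([set w | all (fun q => X q.1 w == q.2) ((v, b) :: h)]
      `&` cylinder l `&` A).
  move=> mA; transitivity (prob x
      (([set w | all (fun q => X q.1 w == q.2) h] `&` cylinder l `&` A) `&` at_time v B)).
    by congr (prob x _); rewrite [at_time _ _ `&` _]setIC setIA -setIA [X in _ `&` X]setIC setIA.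
  rewrite prob_at_time_sum//; last by do 2 apply: measurableI => //.
  apply: eq_bigr => b _; congr (prob x _); rewrite E.
  apply/seteqP; split => w /=; first by move=> [[[? ?] ?] ->]; rewrite eqxx.
  by move=> [[/andP[/eqP ? ?] ?] ?].
rewrite -[X in prob x X](setIA _ (at_time s _)) S; last by apply: measurableI; exact: mat.
rewrite S; last exact: mat.
rewrite mulr_suml; apply: eq_bigr => b _; rewrite setIA IH//=.
by rewrite v0 vs.
Qed.

(** A future is encoded by waiting times, so that the Markov property can be
    iterated by induction from the front; [schedule] dates it from time [s]. *)
Fixpoint schedule s f : seq (R * {set config n}) :=
  if f is q :: f' then (s + q.1, q.2) :: schedule (s + q.1) f' else [::].

Fixpoint schedule_weight x f : R :=
  if f is q :: f' then \sum_(y in q.2) transition q.1 x y * schedule_weight y f'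
  else 1.

Lemma schedule_ge0 s f : 0 <= s -> all (fun q => 0 <= q.1) f ->
  all (fun q => 0 <= q.1) (schedule s f).
Proof.
elim: f s => [//|q f IH] s s0 /= /andP[q0 f0].
by rewrite addr_ge0//= IH// addr_ge0.
Qed.

Lemma markov_schedule_weight x l s z f : all (fun q => 0 <= q.1 <= s) l ->
  0 <= s -> all (fun q => 0 <= q.1) f ->
  prob x (cylinder l `&` at_time s [set z]%SET `&` cylinder (schedule s f)) =
  prob x (cylinder l `&` at_time s [set z]%SET) * schedule_weight z f.
Proof.
elim: f l s z => [|[u B] f IH] l s z ls s0 /=.
  by rewrite cylinder_nil setIT mulr1.
move=> /andP[u0 f0]; have su0 : 0 <= s + u by rewrite addr_ge0.
have ml : measurable (cylinder l).
  by apply: measurable_cylinder; apply: sub_all ls => q /andP[].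
have mz : measurable (at_time s [set z]%SET) by exact: measurable_at_time.
have mf : measurable (cylinder (schedule (s + u) f)).
  by apply: measurable_cylinder; exact: schedule_ge0.
rewrite cylinder_cons /= [at_time _ B `&` _]setIC setIA prob_at_time_sum//; last first.
  by do 2 apply: measurableI => //.
rewrite mulr_sumr; apply: eq_bigr => y _.
rewrite mulrA -markov_cylinder// [X in prob x X = _]setIAC.
have -> : cylinder l `&` at_time s [set z]%SET = cylinder ((s, [set z]%SET) :: l).
  by rewrite cylinder_cons setIC.
apply: IH => //=; rewrite s0 lerDl u0/=.
by apply: sub_all ls => q /andP[-> /le_trans]; apply; rewrite lerDl.
Qed.

Lemma prob_start x : prob x (at_time 0 [set x]%SET) = 1.
Proof.
rewrite /prob (_ : at_time _ _ = [set w | X 0 w = x]) ?(markov_start XP)//.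
by apply/seteqP; split => w; rewrite /at_time/= inE => /eqP.
Qed.

Lemma markov_schedule x l s z f : all (fun q => 0 <= q.1 <= s) l ->
  0 <= s -> all (fun q => 0 <= q.1) f ->
  prob x (cylinder l `&` at_time s [set z]%SET `&` cylinder (schedule s f)) =
  prob x (cylinder l `&` at_time s [set z]%SET) *
  prob z (cylinder (schedule 0 f)).
Proof.
move=> ls s0 f0; rewrite markov_schedule_weight//; congr (_ * _).
have m0 : measurable (at_time 0 [set z]%SET) by exact: measurable_at_time.
have mf : measurable (cylinder (schedule 0 f)).
  by apply: measurable_cylinder; exact: schedule_ge0.
rewrite -(prob_setI_sum1 mf m0 (prob_start z)).
have := @markov_schedule_weight z [::] 0 z f erefl (lexx _) f0.
rewrite cylinder_nil !setTI.
by move=> ->; rewrite prob_start mul1r.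
Qed.

Lemma schedule_cat s f f' :
  schedule s (f ++ f') = schedule s f ++ schedule (s + \sum_(q <- f) q.1) f'.
Proof.
elim: f s => [|q f IH] s /=; first by rewrite big_nil addr0.
by rewrite IH big_cons addrA.
Qed.

Variable S : {set config n}.

Definition alive s t : set Omega :=
  [set w | forall u, s <= u <= s + t -> X u w \in S].

(** The visit at delay [0] constrains the starting point as well. *)
Definition mesh t (k : nat) : seq (R * {set config n}) :=
  (0, S) :: nseq (2 ^ k)%N (t / 2 ^+ k, S).

Lemma mesh_ge0 t k : 0 <= t -> all (fun q => 0 <= q.1) (mesh t k).
Proof. by move=> t0; rewrite /= lexx all_nseq/= divr_ge0// ?orbT. Qed.

Lemma cylinder_schedule_nseq s u (m : nat) w :
  cylinder (schedule s (nseq m (u, S))) w <->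
  (forall j, (0 < j <= m)%N -> X (s + j%:R * u) w \in S).
Proof.
elim: m s => [|m IH] s /=.
  by split => // _ j; rewrite leqn0 lt0n => /andP[/negP].
have E j : s + j.+1%:R * u = s + u + j%:R * u by rewrite mulrSr; ring.
rewrite cylinder_cons; split => [[/= X1 /IH H] [//|j]|H].
  rewrite ltnS E /= => jm; case: j jm => [_|j jm]; first by rewrite mul0r addr0.
  exact: H.
split => /=; first by have := H 1%N erefl; rewrite mul1r.
by apply/IH => j /andP[j0 jm]; rewrite -E; apply: H.
Qed.

Lemma cylinder_mesh s t k w : cylinder (schedule s (mesh t k)) w <->
  (forall j, (j <= 2 ^ k)%N -> X (s + j%:R * (t / 2 ^+ k)) w \in S).
Proof.
rewrite /= cylinder_cons/= addr0; split => [[/= X0 /cylinder_schedule_nseq H] j jk|H].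
  by case: j jk => [_|j jk]; [rewrite mul0r addr0|exact: H].
split; first by have := H 0%N; rewrite mul0r addr0; exact.
by apply/cylinder_schedule_nseq => j /andP[_]; exact: H.
Qed.

Lemma mesh_decr s t : 0 <= t ->
  {homo (fun k => cylinder (schedule s (mesh t k))) : k m / (k <= m)%N >-> (m <= k)%O}.
Proof.
move=> t0 k m km; apply/subsetPset => w /cylinder_mesh H.
apply/cylinder_mesh => j jk.
have := H (j * 2 ^ (m - k))%N; rewrite -{2}(subnKC km) expnD leq_mul2r jk orbT.
have -> : (j * 2 ^ (m - k))%:R * (t / 2 ^+ m) = j%:R * (t / 2 ^+ k) :> R.
  rewrite -[in 2 ^+ m](subnKC km) exprD natrM natrX; field.
  by rewrite !expf_neq0.
exact.
Qed.

(** Right-continuity: leaving [S] lasts for a positive time, which a fine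
    enough mesh detects. *)
Lemma aliveE s t : 0 <= s -> 0 <= t ->
  alive s t = \bigcap_k cylinder (schedule s (mesh t k)).
Proof.
move=> s0 t0; apply/seteqP; split => [w H k _|w H u /andP[su ut]].
  apply/cylinder_mesh => j jk; apply: H.
  rewrite lerDl mulr_ge0 ?divr_ge0//= lerD2l mulrA ler_pdivrMr ?exprn_gt0//.
  by rewrite mulrC ler_wpM2l// -natrX ler_nat.
have {}H k j : (j <= 2 ^ k)%N -> X (s + j%:R * (t / 2 ^+ k)) w \in S.
  by have /cylinder_mesh := H k I; apply.
move: ut; rewrite le_eqVlt => /predU1P[->|ut].
  by have := H 0%N 1%N; rewrite expr0 divr1 mul1r; exact.
have t_gt0 : 0 < t by move: (le_lt_trans su ut); rewrite ltrDl.
have u0 : 0 <= u := le_trans s0 su.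
have [e /= e0 eX] := markov_right XP w u0.
have [k ke] : exists k, t / 2 ^+ k < e.
  exists (Num.truncn (t / e)).+1; rewrite ltr_pdivrMr ?exprn_gt0// mulrC.
  rewrite -ltr_pdivrMr//; apply: lt_trans (truncnS_gt _) _.
  by rewrite -natrX ltr_nat ltn_expl.
set del := t / 2 ^+ k in ke H *; have del0 : 0 < del by rewrite divr_gt0// exprn_gt0.
(* The state at [u] is read at the first mesh point after [u]. *)
pose j := Num.truncn ((u - s) / del).
have us0 : 0 <= (u - s) / del by rewrite divr_ge0 ?subr_ge0// ltW.
have /andP[jlo jhi] := truncn_itv us0.
rewrite -(eX (s + j.+1%:R * del)).
- apply: (H k); rewrite -(ltr_nat R) natrX; apply: le_lt_trans jlo _.
  rewrite ltr_pdivrMr// /del mulrC divfK ?expf_neq0//.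
  by rewrite ltrBlDl.
- rewrite /ball/=; move: jlo; rewrite ler_pdivlMr// -/j => jlo.
  move: jhi; rewrite ltr_pdivrMr// -/j => jhi.
  rewrite ltr_norml; move: jlo jhi; rewrite mulrSr mulrDl mul1r; lra.
- by move: jhi; rewrite ltr_pdivrMr// -/j ltrBlDl.
Qed.

Lemma measurable_alive s t : 0 <= s -> 0 <= t -> measurable (alive s t).
Proof.
move=> s0 t0; rewrite aliveE//; apply: bigcapT_measurable => k.
by apply: measurable_cylinder; apply: schedule_ge0 => //; exact: mesh_ge0.
Qed.

Lemma cvg_prob x (F : nat -> set Omega) : (forall k, measurable (F k)) ->
  {homo F : k m / (k <= m)%N >-> (m <= k)%O} ->
  prob x (F k) @[k --> \oo] --> prob x (\bigcap_k F k).
Proof.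
move=> mF ndF; have mI : measurable (\bigcap_k F k) by exact: bigcapT_measurable.
apply: fine_cvg; rewrite -probE//; apply: nonincreasing_cvg_mu => //.
 by rewrite (le_lt_trans (probability_le1 _ _)) ?ltry.
Qed.

Lemma schedule_bounds s f : all (fun q => 0 <= q.1) f ->
  all (fun q => s <= q.1 <= s + \sum_(q <- f) q.1) (schedule s f).
Proof.
elim: f s => [//|q f IH] s /= /andP[q0 f0].
rewrite big_cons addrA lerDl q0 lerDl/= [X in 0 <= X]big_seq.
rewrite sumr_ge0/=; last by move=> i /(allP f0).
apply: sub_all (IH (s + q.1) f0) => p /andP[+ ->]; rewrite andbT.
by apply: le_trans; rewrite lerDl.
Qed.

Lemma sum_mesh t k : \sum_(q <- mesh t k) q.1 = t.
Proof.
rewrite big_cons add0r big_nseq iter_addr_0 -(mulr_natr _ (2 ^ k)) natrX.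
by rewrite divfK ?expf_neq0.
Qed.

(** The Markov property for the event of staying in [S], obtained along a
    decreasing sequence of cylinders. *)
Lemma markov_alive x s z t y : 0 <= s -> 0 <= t ->
  prob x (alive 0 s `&` at_time s [set z]%SET `&`
    (alive s t `&` at_time (s + t) [set y]%SET)) =
  prob x (alive 0 s `&` at_time s [set z]%SET) *
  prob z (alive 0 t `&` at_time t [set y]%SET).
Proof.
move=> s0 t0; have st0 : 0 <= s + t by rewrite addr_ge0.
pose C a v k := cylinder (schedule a (mesh v k)).
have mC a v k : 0 <= a -> 0 <= v -> measurable (C a v k).
  by move=> a0 v0; apply: measurable_cylinder; apply: schedule_ge0 => //; exact: mesh_ge0.
have mE v w : 0 <= v -> measurable (at_time v [set w]%SET).
  by move=> v0; exact: measurable_at_time.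
have dC a v : 0 <= v -> forall k m, (k <= m)%N -> C a v m `<=` C a v k.
  by move=> v0 k m km; apply/subsetPset; exact: mesh_decr.
have cvg1 : prob x (C 0 s k `&` at_time s [set z]%SET `&`
      (C s t k `&` at_time (s + t) [set y]%SET)) @[k --> \oo] -->
    prob x (alive 0 s `&` at_time s [set z]%SET `&`
      (alive s t `&` at_time (s + t) [set y]%SET)).
  rewrite !aliveE//.
  rewrite (_ : _ `&` (_ `&` _) = \bigcap_k (C 0 s k `&` at_time s [set z]%SET `&`
      (C s t k `&` at_time (s + t) [set y]%SET))).
    apply: cvg_prob => [k|k m km].
      by apply: measurableI; apply: measurableI; [exact: mC|exact: mE|exact: mC|exact: mE].
    by apply/subsetPset => w [[? ?] [? ?]]; split; split => //; exact: dC km _ _.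
  apply/seteqP; split => [w [[h1 h2] [h3 h4]] k _|w H].
    by split; split => //; [exact: h1|exact: h3].
  by split; split; do ?[move=> k _]; do ?[by case: (H 0%N I) => [[? ?] [? ?]]];
     case: (H k I) => [[? ?] [? ?]].
have cvg2 v a w : 0 <= v ->
    prob a (C 0 v k `&` at_time v [set w]%SET) @[k --> \oo] -->
    prob a (alive 0 v `&` at_time v [set w]%SET).
  move=> v0; rewrite !aliveE// -bigcapIl; last by exists 0%N.
  apply: cvg_prob => [k|k m km].
    by apply: measurableI; [exact: mC|exact: mE].
  by apply/subsetPset => ? [? ?]; split => //; exact: dC km _ _.
apply: (cvg_unique _ cvg1); first exact: norm_hausdorff.
apply: cvg_trans (cvgM (cvg2 s x z s0) (cvg2 t z y t0)).
apply: near_eq_cvg; near=> k; apply/esym.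
have H a v w : 0 <= v -> C a v k `&` at_time (a + v) [set w]%SET =
    cylinder (schedule a (mesh v k ++ [:: (0, [set w]%SET)])).
  move=> v0; rewrite schedule_cat cylinder_cat sum_mesh; congr (_ `&` _).
  by rewrite cylinder_cons cylinder_nil setIT/= addr0.
have H0 v w : 0 <= v -> C 0 v k `&` at_time v [set w]%SET =
    cylinder (schedule 0 (mesh v k ++ [:: (0, [set w]%SET)])).
  by move=> v0; rewrite -H// add0r.
transitivity (prob x (C 0 s k `&` at_time s [set z]%SET) *
  prob z (C 0 t k `&` at_time t [set y]%SET)); last by [].
rewrite H// (H0 t)// markov_schedule//.
- by have := schedule_bounds 0 (mesh_ge0 k s0); rewrite sum_mesh add0r.
- by rewrite all_cat mesh_ge0//= lexx.
Unshelve. all: by end_near.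
Qed.

Definition killed_transition t x y : R := prob x (alive 0 t `&` at_time t [set y]%SET).

Lemma at_time_setT t : at_time t finset.setT = setT.
Proof. by apply/seteqP; split => w //= _; rewrite /at_time/= inE. Qed.

Lemma prob_sum_at_time x A t : measurable A -> 0 <= t ->
  prob x A = \sum_y prob x (A `&` at_time t [set y]%SET).
Proof.
move=> mA t0; rewrite -[in LHS](setIT A) -(at_time_setT t) prob_at_time_sum//.
by apply: eq_bigl => y; rewrite inE.
Qed.

Lemma killed_semigroup_process : killed_semigroup transition killed_transition.
Proof.
have mE v w : 0 <= v -> measurable (at_time v [set w]%SET).
  by move=> v0; exact: measurable_at_time.
split => [t x y t0|t x y t0|t x t0|s t x y s0 t0|s t x y s0 t0].
- exact: prob_ge0.
- apply: prob_le; [|exact: mE|by move=> w []].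
  by apply: measurableI; [exact: measurable_alive|exact: mE].
- have <- : prob x setT = 1 by rewrite /prob (@probability_setT _ _ _ (P x)).
  rewrite /transition (prob_sum_at_time x _ t0)//.
  by apply: eq_bigr => y _; rewrite setTI.
- have st0 : 0 <= s + t by rewrite addr_ge0.
  rewrite /transition (prob_sum_at_time _ _ s0)//; last exact: mE.
  apply: eq_bigr => z _; have := @markov_cylinder x [::] s z t y erefl s0 t0.
  rewrite cylinder_nil !setTI.
  by move=> <-; rewrite setIC.
- have st0 : 0 <= s + t by rewrite addr_ge0.
  rewrite /killed_transition (prob_sum_at_time _ _ s0)//; last first.
    by apply: measurableI; [exact: measurable_alive|exact: mE].
  apply: eq_bigr => z _; rewrite -markov_alive//; congr (prob x _).
  apply/seteqP; split => w; rewrite /alive/= !add0r.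
    move=> [[H ?] ?]; split; split => //= u /andP[u0 us]; apply: H.
      by rewrite u0 (le_trans us)// lerDl.
    by rewrite us andbT (le_trans s0).
  move=> [[H1 ?] [H2 ?]]; split => //; split => // u /andP[u0 us].
  by have [?|/ltW ?] := leP u s; [apply: H1; rewrite u0|apply: H2; apply/andP].
Qed.

Lemma survivalE t x : 0 <= t -> survival killed_transition t x = prob x (alive 0 t).
Proof.
by move=> t0; rewrite [RHS](prob_sum_at_time _ _ t0)//; exact: measurable_alive.
Qed.

Lemma invariant_process (mu : config n -> R) : stationary P X mu ->
  invariant_proba transition mu.
Proof.
move=> [mu0 mu1 muP]; split => // t y t0.
by have := muP t [set y]%SET t0; rewrite big_set1.
Qed.

End killed_process.

(** * Hitting times and their stationary mean *)

Section hitting.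
Context {R : realType} {n : nat} {L : (config n -> R) -> config n -> R}.
Context {d : measure_display} {Omega : measurableType d}.
Variables (P : config n -> probability Omega R) (X : R -> Omega -> config n).
Hypothesis XP : is_markov_process L P X.
Variable O : set (Mplus R).
Local Notation H := (hitting_time X O).

Definition outside : {set config n} := [set x | ~~ `[< O (empirical R x) >]]%SET.

(** The infimum that defines [H] is attained by right-continuity, which gives the
    strict inequality. *)
Lemma hitting_time_gt (t : R) (w : Omega) : 0 <= t ->
  (t%:E < H w)%E <-> alive X outside 0 t w.
Proof.
move=> t0; rewrite /alive/= add0r; split => [tH u /andP[u0 ut]|tA].
  rewrite inE; apply/asboolPn => Xu; move: tH; apply/negP; rewrite -leNgt.
  by apply: (@le_trans _ _ u%:E); [apply: ereal_inf_lbound; exists u|rewrite lee_fin].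
have [e /= e0 eX] := markov_right XP w t0.
apply: (@lt_le_trans _ _ (t + e)%:E); first by rewrite lte_fin ltrDl.
apply: le_ereal_inf_tmp => _ [u [u0 Xu] <-]; rewrite lee_fin leNgt; apply/negP => ue.
have tXu v : X v w \in outside -> X v w = X u w -> False.
  by move=> /[swap] ->; rewrite inE => /asboolPn.
have [ut|tu] := leP u t; first by apply: (tXu u) => //; apply: tA; rewrite u0.
apply: (tXu t); first by apply: tA; rewrite t0 lexx.
by apply/esym/eX => //; rewrite /ball/= distrC ger0_norm ?subr_ge0 ?ltW// ltrBlDl.
Qed.

Lemma hitting_time_ge0 (w : Omega) : (0 <= H w)%E.
Proof. by apply: le_ereal_inf_tmp => _ [u [u0 _] <-]; rewrite lee_fin. Qed.

Lemma hitting_time_le (t : R) : 0 <= t ->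
  [set w | (H w <= t%:E)%E] = ~` alive X outside 0 t.
Proof.
move=> t0; apply/seteqP; split => w /=; rewrite -(hitting_time_gt w t0) leNgt.
  by move=> /negP.
by move=> h; apply/negP.
Qed.

Lemma measurable_hitting_time : measurable_fun setT (H : Omega -> \bar R).
Proof.
move=> _; apply: (measurability _ (ErealGenOInfty.measurableE R)) => //.
move=> /= _ [_ [t ->]] <-; rewrite setTI preimage_itvoy.
have [t0|t0] := leP 0 t.
  rewrite (_ : mkset _ = alive X outside 0 t); first exact: (measurable_alive XP).
  by apply/seteqP; split => w /= /hitting_time_gt; apply.
rewrite (_ : mkset _ = setT) //; apply/seteqP; split => w //= _.
by rewrite (lt_le_trans _ (hitting_time_ge0 w))// lte_fin.
Qed.

Variables (T : R) (T_gt0 : 0 < T).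
Let A j := alive X outside 0 (j%:R * T).
Let jT_ge0 (j : nat) : 0 <= j%:R * T. Proof. by rewrite mulr_ge0 // ltW. Qed.
Let mA j : measurable (A j). Proof. exact: (measurable_alive XP). Qed.

Lemma steps_le_hitting_time (m : nat) (w : Omega) :
  (\sum_(0 <= j < m) T%:E * (\1_(A j.+1) w)%:E <= H w)%E.
Proof.
elim: m => [|m IH]; first by rewrite big_nil hitting_time_ge0.
rewrite big_nat_recr//= indicE.
have [|_] := boolP (w \in A m.+1); last by rewrite mule0 adde0.
rewrite inE => /(hitting_time_gt w (jT_ge0 _)) /ltW; apply: le_trans.
rewrite mule1 mulrSr mulrDl mul1r EFinD leeD2r//.
apply: (@le_trans _ _ (\sum_(0 <= j < m) T%:E)%E).
  by apply: lee_sum => j _; rewrite -EFinM lee_fin ler_piMr// ltW.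
by rewrite sumEFin lee_fin sumr_const_nat subn0 mulr_natl.
Qed.

Lemma hitting_time_le_steps (w : Omega) :
  (H w <= \sum_(0 <= j <oo) T%:E * (\1_(A j) w)%:E)%E.
Proof.
have f0 (j : nat) : (0%R <= T%:E * (\1_(A j) w)%:E)%E.
  by rewrite -EFinM lee_fin mulr_ge0// ltW.
have part (m : nat) : (forall j, (j < m)%N -> A j w) ->
    ((m%:R * T)%:E <= \sum_(0 <= j <oo) T%:E * (\1_(A j) w)%:E)%E.
  move=> Aw; apply: le_trans (nneseries_lim_ge m _); last by move=> *.
  rewrite (eq_big_nat _ _ (F2 := fun=> T%:E)).
    by rewrite sumEFin lee_fin sumr_const_nat subn0 mulr_natl.
  by move=> j /andP[_ /Aw Aj]; rewrite indicE mem_set// mule1.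
have [exA|Aw] := pselect (exists j, `[< ~ A j w >]).
  have [m /asboolP Am min] := ex_minnP exA.
  apply: (@le_trans _ _ (m%:R * T)%:E).
    by rewrite leNgt; apply/negP => /(hitting_time_gt w (jT_ge0 _)).
  apply: part => i im; apply: contrapT => Ai.
  by have := min i; rewrite leqNgt im => /(_ (asboolT Ai)).
rewrite (_ : (\sum_(0 <= j <oo) _)%E = +oo%E) ?leey//.
apply/eqyP => r r0; pose m := (Num.truncn (r / T)).+1.
apply: (@le_trans _ _ (m%:R * T)%:E).
  by rewrite lee_fin -ler_pdivrMr// ltW// truncnS_gt.
by apply: part => j _; apply: contrapT => Aj; apply: Aw; exists j; apply/asboolP.
Qed.

Variables (mu : config n -> R) (mu_stat : stationary P X mu).
Local Notation Q := (killed_transition P X outside).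
Local Notation S := (fun j : nat => average mu (survival Q (j%:R * T))).
Hypothesis S_cvg : cvgn (series S).

(** The mean is the integral of the tail of [H], which lies between the lower
    and the upper Riemann sums of mesh [T]; these differ by the first term, at
    most [T]. *)
Lemma stationary_mean_bounds : exists m : R,
  [/\ stationary_mean P mu H = m%:E, T * (limn (series S) - 1) <= m &
      m <= T * limn (series S)].
Proof.
have pmu := invariant_process mu_stat.
have pQ := killed_semigroup_process XP outside.
have mu0 x : (0 <= (mu x)%:E)%E by rewrite lee_fin (invariant_ge0 pmu).
have mI j : measurable_fun setT (fun w => (\1_(A j) w)%:E : \bar R).
  by apply/measurable_EFinP; apply: measurable_indic; exact: mA.
have mF j : measurable_fun setT (fun w => T%:E * (\1_(A j) w)%:E : \bar R)%E.
  exact: measurable_funeM.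
have F0 j w : (0 <= T%:E * (\1_(A j) w)%:E :> \bar R)%E.
  by rewrite -EFinM lee_fin mulr_ge0// ltW.
have intF x j : (\int[P x]_w (T%:E * (\1_(A j) w)%:E) =
    (T * survival Q (j%:R * T) x)%:E)%E.
  rewrite ge0_integralZl_EFin ?ltW// integral_indic// setIT.
  by rewrite (survivalE XP)// EFinM -(probE P x (mA j)).
have Ts0 x j : 0 <= T * survival Q (j%:R * T) x.
  by apply: mulr_ge0; [exact: ltW|exact: (survival_ge0 pQ)].
have S0 j : 0 <= S j by exact: (average_survival_ge0 pQ).
have up : (stationary_mean P mu H <= (T * limn (series S))%:E)%E.
  apply: (@le_trans _ _ (\sum_x (mu x)%:E *
      \sum_(0 <= j <oo) (T * survival Q (j%:R * T) x)%:E)%E).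
    apply: lee_sum => x _; apply: lee_wpmul2l => //.
    under [leRHS]eq_eseriesr do rewrite -intF.
    rewrite -integral_nneseries//; apply: ge0_le_integral => //.
    - by move=> w _; exact: hitting_time_ge0.
    - exact: measurable_hitting_time.
    - exact: ge0_emeasurable_sum.
    - by move=> w _; exact: hitting_time_le_steps.
  have E x : ((mu x)%:E * \sum_(0 <= j <oo) (T * survival Q (j%:R * T) x)%:E =
      \sum_(0 <= j <oo) (mu x)%:E * (T * survival Q (j%:R * T) x)%:E)%E.
    by rewrite nneseriesZl// => j _; rewrite lee_fin Ts0.
  under eq_bigr do rewrite E.
  rewrite -nneseries_sum; last first.
    by move=> x j _; rewrite mule_ge0// lee_fin Ts0.
  rewrite (_ : (fun m => _) = EFin \o (fun m => T * series S m)); last first.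
    apply/funext => m /=; rewrite /series/= mulr_sumr -sumEFin.
    apply: eq_bigr => j _; rewrite /average mulr_sumr -sumEFin.
    by apply: eq_bigr => x _; rewrite -EFinM mulrCA.
  have TS : T * series S m @[m --> \oo] --> T * limn (series S).
    by apply: cvgM => //; exact: cvg_cst.
  by rewrite EFin_lim; [rewrite (cvg_lim _ TS)|exact: cvgP TS].
have lo m : ((T * \sum_(0 <= j < m) S j.+1)%:E <= stationary_mean P mu H)%E.
  rewrite (_ : T * _ = \sum_x mu x * \sum_(0 <= j < m) T * survival Q (j.+1%:R * T) x).
    rewrite -sumEFin; apply: lee_sum => x _; rewrite EFinM lee_wpmul2l// -sumEFin.
    under eq_bigr do rewrite -intF.
    rewrite -ge0_integral_sum//; apply: ge0_le_integral => //.
    - by move=> w _; apply: sume_ge0.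
    - exact: emeasurable_sum.
    - exact: measurable_hitting_time.
    - by move=> w _; exact: steps_le_hitting_time.
  rewrite mulr_sumr; under [RHS]eq_bigr do rewrite mulr_sumr.
  rewrite exchange_big/=; apply: eq_bigr => j _; rewrite /average mulr_sumr.
  by apply: eq_bigr => x _; rewrite mulrCA.
have mean_fin : stationary_mean P mu H \is a fin_num.
  rewrite ge0_fin_numE; first exact: le_lt_trans up (ltry _).
  by have := lo 0%N; rewrite big_nil mulr0.
exists (fine (stationary_mean P mu H)); rewrite fineK//; split => //.
- rewrite mulrC -ler_pdivlMr// lerBlDr; apply: limr_le => //; near=> m.
  apply: (@le_trans _ _ (series S m.+1)); first by rewrite seriesSr lerDl.
  rewrite /series/= big_nat_recl// addrC lerD//; last first.
    exact: (average_survival_le1 pQ).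
  rewrite ler_pdivlMr// mulrC -lee_fin fineK//; exact: lo.
- by rewrite -lee_fin fineK.
Unshelve. all: by end_near.
Qed.

End hitting.

(** * Approximation of densities by configurations *)

Section rounding.
Context {R : realType}.
Variable a : nat -> R.
Hypothesis a01 : forall i, 0 <= a i <= 1.
Local Notation S := (series a).

(** Keep a particle at [k] when the cumulated mass crosses an integer there:
    the number of particles then never differs from the cumulated mass by more
    than one. *)
Definition rounding (k : nat) : bool := Num.truncn (S k.+1) != Num.truncn (S k).

Let S_ge0 k : 0 <= S k.
Proof. by apply: sumr_ge0 => i _; case/andP: (a01 i). Qed.

Lemma truncn_seriesS k :
  Num.truncn (S k.+1) = (Num.truncn (S k) + rounding k)%N.
Proof.
rewrite /rounding seriesSr; have /andP[a0 a1] := a01 k.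
have /andP[lo hi] := truncn_itv (S_ge0 k).
have /andP[lo' hi'] := truncn_itv (addr_ge0 (S_ge0 k) a0).
have [->|ne /=] := eqVneq; first by rewrite addn0.
apply/eqP; rewrite addn1 eqn_leq; apply/andP; split.
  rewrite -ltnS -(ltr_nat R) (le_lt_trans lo')//.
  by rewrite [ltRHS]mulrSr ltr_leD.
rewrite ltn_neqAle eq_sym ne/= -ltnS -(ltr_nat R) (le_lt_trans lo)//.
by rewrite (le_lt_trans _ hi')// lerDl.
Qed.

Lemma rounding_discrepancy k : `|\sum_(0 <= i < k) (a i - (rounding i)%:R)| <= 1.
Proof.
rewrite (_ : \sum_(0 <= i < k) _ = S k - (Num.truncn (S k))%:R).
  by have /andP[lo hi] := truncn_itv (S_ge0 k); rewrite ler_norml; apply/andP;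
     split; move: lo hi; rewrite mulrSr; lra.
elim: k => [|k IH].
  by rewrite big_nil /series/= big_nil truncn0 subr0.
by rewrite big_nat_recr//= IH truncn_seriesS seriesSr natrD; ring.
Qed.

End rounding.

(** Summation by parts: only the partial sums of [delta] have to be bounded. *)
Lemma abel_le (R : realType) (g delta : nat -> R) (b e : R) :
  (forall k, `|\sum_(0 <= i < k) delta i| <= 1) ->
  (forall k, `|g k| <= b) -> (forall k, `|g k.+1 - g k| <= e) ->
  forall k, `|\sum_(0 <= i < k) g i * delta i| <= b + k%:R * e.
Proof.
move=> D1 gb ge k.
have -> : \sum_(0 <= i < k) g i * delta i = g k * \sum_(0 <= i < k) delta i -
    \sum_(0 <= i < k) (g i.+1 - g i) * \sum_(0 <= j < i.+1) delta j.
  elim: k => [|k IH]; first by rewrite !big_nil mulr0 subr0.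
  by rewrite !(big_nat_recr k)//= IH; ring.
apply: (le_trans (ler_normB _ _)); apply: lerD.
  by rewrite normrM -[leRHS]mulr1 ler_pM.
apply: (le_trans (ler_norm_sum _ _ _)).
rewrite -[k%:R]/(k%:R : R) mulr_natl -[k in leRHS]subn0 -sumr_const_nat.
by apply: ler_sum => i _; rewrite normrM -[leRHS]mulr1 ler_pM.
Qed.

Section cells.
Context {R : realType} (n : nat).
Local Notation N := (n.+1%:R : R).

Definition cell (k : nat) : set (measurableTypeR R) := `[k%:R / N, k.+1%:R / N[.

Let cells (k : nat) : set (measurableTypeR R) := `[0, k%:R / N[.

Let N_gt0 : 0 < N. Proof. by rewrite ltr0n. Qed.

Let mcell k : measurable (cell k). Proof. exact: measurable_itv. Qed.
Let mcells k : measurable (cells k). Proof. exact: measurable_itv. Qed.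

Let cellsS k : cells k.+1 = cells k `|` cell k.
Proof.
apply/seteqP; split => x; rewrite /cells /cell/= !in_itv/=.
  by move=> /andP[-> ->]; rewrite andbT; have [] := ltP x (k%:R / N); [left|right].
move=> [/andP[-> /lt_trans]|/andP[/(le_trans _) h ->]].
  by apply; rewrite ltr_pM2r ?invr_gt0// ltr_nat.
by rewrite andbT; apply: h; rewrite divr_ge0.
Qed.

Let cells_disj k : [disjoint cells k & cell k].
Proof.
apply/disj_setPS => x; rewrite /cells /cell/= !in_itv/= => -[/andP[_ x1] /andP[x2 _]].
by move: (lt_le_trans x1 x2); rewrite ltxx.
Qed.

Variables (m : Mplus R) (G : R -> R) (b K : R).
Hypothesis G_bd : forall x, `|G x| <= b.
Hypothesis G_lip : forall x y, `|G x - G y| <= K * `|x - y|.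

Let m_fin (A : set (measurableTypeR R)) : measurable A -> (m A < +oo)%E.
Proof.
move=> mA; apply: (@le_lt_trans _ _ 1%E); last exact: ltry.
by apply: le_trans (mplus_mass m); apply: le_measure; rewrite ?inE.
Qed.

Let K_ge0 : 0 <= K.
Proof. by have := G_lip 1 0; rewrite subr0 normr1 mulr1; apply: le_trans. Qed.

Let G_meas : measurable_fun setT G.
Proof.
apply: continuous_measurable_fun => x; apply/(@cvgrPdist_lt _ R^o) => e e0.
have K1 : 0 < K + 1 by rewrite ltr_wpDl.
near=> y; apply: le_lt_trans (G_lip _ _) _.
apply: (@le_lt_trans _ _ ((K + 1) * `|x - y|)); first by rewrite ler_wpM2r// lerDl.
rewrite mulrC -ltr_pdivlMr//; near: y.
exact: (nbhsx_ballx x _ (divr_gt0 e0 K1)).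
Unshelve. all: by end_near. Qed.

Let G_int (A : set (measurableTypeR R)) : measurable A ->
  m.-integrable A (EFin \o G).
Proof.
move=> mA; apply: measurable_bounded_integrable => //.
- exact: m_fin.
- exact: measurable_funTS.
- exists b; split; first by rewrite num_real.
  by move=> z bz x _ /=; rewrite (le_trans (G_bd x))// ltW.
Qed.

Let cell_int k : `|\int[m]_(x in cell k) G x - G (k%:R / N) * fine (m (cell k))|
  <= K / N * fine (m (cell k)).
Proof.
have cst_int (r : R) : m.-integrable (cell k) (EFin \o cst r).
  apply: measurable_bounded_integrable => //; first exact: m_fin.
  by exists `|r|; split; [rewrite num_real|move=> z rz x _; exact: ltW].
have sub_int : m.-integrable (cell k) (EFin \o (fun x => G x - G (k%:R / N))).
  exact: (integrableB (mcell k) (G_int (mcell k)) (cst_int _)).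
rewrite -Rintegral_cst// -RintegralB//; [|exact: G_int|exact: cst_int].
apply: le_trans (le_normr_Rintegral _ _) _ => //.
rewrite -Rintegral_cst//; apply: le_Rintegral => //.
- exact: integrable_norm sub_int.
- exact: cst_int.
- move=> x; rewrite /cell/= in_itv/= => /andP[xlo xhi].
  rewrite (le_trans (G_lip _ _))// ler_wpM2l// ger0_norm ?subr_ge0//.
  by rewrite lerBlDl -[X in _ + X]mul1r -mulrDl -mulrSr ltW.
Qed.

(** On a cell, [G] differs by at most [K / N] from its value at the left end. *)
Lemma pairing_cells :
  `|pairing m G - \sum_(0 <= k < n.+1) G (k%:R / N) * fine (m (cell k))| <= K / N.
Proof.
have cells_bound k : `|\int[m]_(x in cells k) G x -
    \sum_(0 <= i < k) G (i%:R / N) * fine (m (cell i))| <= K / N * fine (m (cells k)).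
  elim: k => [|k IH].
    rewrite /cells mul0r set_itvco0 Rintegral_set0 big_nil subrr normr0.
    by rewrite measure0 mulr0.
  rewrite cellsS Rintegral_setU//; last by rewrite -cellsS; exact: G_int.
  rewrite big_nat_recr//= measureU//; last exact/disj_set2P.
  rewrite fineD ?ge0_fin_numE ?m_fin// mulrDr opprD addrACA.
  by apply: (le_trans (ler_normD _ _)); rewrite lerD.
have cE : cells n.+1 = `[0, 1[%classic by rewrite /cells divff// gt_eqF.
have -> : pairing m G = \int[m]_(x in cells n.+1) G x.
  rewrite /pairing -(setUv (cells n.+1)) Rintegral_setU//.
  - rewrite [X in _ + X](_ : _ = 0) ?addr0//.
    rewrite /Rintegral null_set_integral//.
    + exact: measurableC.
    + apply/measurable_EFinP; exact: measurable_funTS.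
    + by rewrite cE mplus_torus.
  - exact: measurableC.
  - by rewrite setUv; exact: G_int.
  - by apply/disj_setPS; rewrite setICr.
apply: le_trans (cells_bound _) _; rewrite ler_piMr ?divr_ge0//.
rewrite -lee_fin fineK ?ge0_fin_numE ?m_fin//.
by apply: le_trans (mplus_mass m); apply: le_measure; rewrite ?inE.
Qed.

End cells.

Lemma is_density_cell (R : realType) (n k : nat) (m : Mplus R) (rho : R -> R) :
  is_density m rho -> (k <= n)%N ->
  0 <= n.+1%:R * fine (m (cell n k)) <= 1.
Proof.
move=> [mrho rho01 mE] kn; rewrite mulr_ge0//=.
rewrite -ler_pdivlMl ?ltr0n// mulr1.
have mc : measurable (cell n k : set (measurableTypeR R)) by exact: measurable_itv.
have cT : (cell n k : set R) `<=` `[0%R, 1%R[.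
  move=> x; rewrite /cell/= !in_itv/= => /andP[h1 h2]; apply/andP; split.
    by apply: le_trans h1; rewrite divr_ge0.
  by apply: (lt_le_trans h2); rewrite ler_pdivrMr ?ltr0n// mul1r ler_nat.
have lE : @lebesgue_measure R (cell n k) = (n.+1%:R^-1)%:E.
  rewrite lebesgue_measure_itv/= lte_fin ltr_pM2r ?invr_gt0 ?ltr0n// ltr_nat ltnS leqnn.
  by rewrite -EFinD -mulrBl -natrB// subSnn mul1r.
have H : (m (cell n k) <= (n.+1%:R^-1)%:E)%E.
  have mrhoc : measurable_fun (cell n k) (EFin \o rho).
    by apply/measurable_EFinP; apply: measurable_funS mrho => //; exact: measurable_itv.
  have mmax : measurable_fun (cell n k) (EFin \o (fun x => Num.max (rho x) 0)).
    apply/measurable_EFinP; apply: measurable_maxr => //.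
    exact/measurable_EFinP.
  rewrite mE// (setIidl cT) -lE -[leRHS]mul1e -(integral_cst _ mc).
  have aec (Q : R -> Prop) : (forall r, 0 <= r <= 1 -> Q r) ->
      {ae @lebesgue_measure R, forall x : R, cell n k x -> Q (rho x)}.
    move=> HQ; apply: negligibleS rho01; apply: subsetC => x h cx.
    by apply/HQ/h; exact: cT.
  (* Off a null set the density agrees with its positive part. *)
  rewrite (@ae_eq_integral _ _ _ (@lebesgue_measure R) _
    (EFin \o (fun x => Num.max (rho x) 0)))//; last first.
    by apply: (aec (fun s => s%:E = (Num.max s 0)%:E)) => s /andP[s0 _]; rewrite max_l.
  apply: ae_ge0_le_integral => //.
    by move=> x _; rewrite lee_fin le_max lexx orbT.
  apply: (aec (fun s => ((Num.max s 0)%:E <= 1)%E)) => s /andP[_ s1].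
  by rewrite lee_fin ge_max s1 ler01.
rewrite -lee_fin fineK//; rewrite ge0_fin_numE//; exact: le_lt_trans H (ltry _).
Qed.

Lemma empirical_cell (R : realType) (n k : nat) (x : config n) : (k <= n)%N ->
  fine (empirical R x (cell n k)) = n.+1%:R^-1 * (x (inord k))%:R.
Proof.
move=> kn; rewrite /empirical/= /mscale/= /msum/=.
rewrite -(big_mkord xpredT (fun i => mscale ((x (inord i))%:R)%:nng
   \d_(i%:R / n.+1%:R : measurableTypeR R) (cell n k))).
rewrite (bigD1_seq k) ?mem_index_iota ?iota_uniq//= big1 => [|i ik].
  rewrite /mscale/= indicE mem_set ?mulr1 ?addr0//.
  by rewrite /cell/= in_itv/= lexx/= ltr_pM2r ?invr_gt0 ?ltr0n// ltr_nat.
rewrite /mscale/= /dirac indicE memNset ?mule0//.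
rewrite /cell/= in_itv/= => /andP[].
rewrite ler_pM2r ?invr_gt0 ?ltr0n// ltr_pM2r ?invr_gt0 ?ltr0n// !ler_nat ltr_nat ltnS.
by move=> ? ?; move: ik; rewrite eqn_leq => /negP; apply; apply/andP.
Qed.

Lemma lipschitz_of_derive (R : realType) (f df : R -> R) (K : R) :
  (forall x : R, is_derive x 1 f (df x)) -> (forall x, `|df x| <= K) ->
  forall x y, `|f x - f y| <= K * `|x - y|.
Proof.
move=> fdf dfK x y; wlog xy : x y / y <= x.
  by move=> h; have [/h//|/ltW/h] := leP y x; rewrite distrC (distrC x).
have cf : {within `[y, x], continuous f}.
  apply: continuous_subspaceT => z; apply: differentiable_continuous.
  by apply/derivable1_diffP; have [] := fdf z.
have [c _ ->] := MVT_segment xy (fun z _ => fdf z) cf.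
by rewrite normrM ler_wpM2r.
Qed.

Lemma fourier_lipschitz (R : realType) (k : int) (x y : R) :
  `|fourier k x - fourier k y| <= Num.sqrt 2 * (2 * pi * `|k|%N%:R) * `|x - y|.
Proof.
have cosl (u v : R) : `|cos u - cos v| <= 1 * `|u - v|.
  by apply: (lipschitz_of_derive (@is_derive_cos R)) => z; rewrite normrN ler_norml sin_geN1 sin_le1.
have sinl (u v : R) : `|sin u - sin v| <= 1 * `|u - v|.
  by apply: (lipschitz_of_derive (@is_derive_sin R)) => z; rewrite ler_norml cos_geN1 cos_le1.
have c0 (j : nat) : 0 <= 2 * pi * j%:R :> R by rewrite !mulr_ge0// pi_ge0.
have red (f : R -> R) (j : nat) : (forall u v, `|f u - f v| <= 1 * `|u - v|) ->
    `|Num.sqrt 2 * f (2 * pi * j%:R * x) - Num.sqrt 2 * f (2 * pi * j%:R * y)| <=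
    Num.sqrt 2 * (2 * pi * j%:R) * `|x - y|.
  move=> fl; rewrite -mulrBr normrM ger0_norm ?sqrtr_ge0// -[leRHS]mulrA.
  rewrite ler_wpM2l ?sqrtr_ge0//; apply: (le_trans (fl _ _)).
  by rewrite mul1r -mulrBr normrM ger0_norm.
case: k => [[|k]|k] /=; [|exact: red|exact: red].
by rewrite subrr normr0 !mulr_ge0// pi_ge0.
Qed.

Lemma fourier_bounded (R : realType) (k : int) (x : R) : `|fourier k x| <= Num.sqrt 2.
Proof.
have s1 : 1 <= Num.sqrt 2 :> R by rewrite -[leLHS]sqrtr1 ler_wsqrtr// ler1n.
have red (u : R) : `|u| <= 1 -> `|Num.sqrt 2 * u| <= Num.sqrt 2.
  by move=> u1; rewrite normrM ger0_norm ?sqrtr_ge0// ler_piMr ?sqrtr_ge0.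
case: k => [[|k]|k] /=; first by rewrite normr1.
  by apply: red; rewrite ler_norml cos_geN1 cos_le1.
by apply: red; rewrite ler_norml sin_geN1 sin_le1.
Qed.

Section approximation.
Context {R : realType} (m : Mplus R) (rho : R -> R) (m_rho : is_density m rho).

Definition rounded_config (n : nat) : config n :=
  [ffun x : 'I_n.+1 => rounding (fun k =>
     if (k <= n)%N then n.+1%:R * fine (m (cell n k)) else 0) x].

(** Only the masses of the cells matter up to the order of the mesh, and there
    the discrepancy of the rounding is summed by parts. *)
Lemma pairing_rounded (n : nat) (k : int) :
  `|pairing m (fourier k) - pairing (empirical R (rounded_config n)) (fourier k)|
  <= n.+1%:R^-1 * (Num.sqrt 2 * (1 + 6 * pi * `|k|%N%:R)).
Proof.
set N := n.+1%:R; have N0 : 0 < N :> R by rewrite ltr0n.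
pose K : R := Num.sqrt 2 * (2 * pi * `|k|%N%:R).
have := pairing_cells n m (@fourier_bounded _ k) (@fourier_lipschitz _ k).
have := pairing_cells n (empirical R (rounded_config n)) (@fourier_bounded _ k)
  (@fourier_lipschitz _ k).
set A := \sum_(0 <= i < n.+1) _ => hA; set B := \sum_(0 <= i < n.+1) _ => hB.
pose a i := if (i <= n)%N then N * fine (m (cell n i)) else 0.
have a01 i : 0 <= a i <= 1.
  by rewrite /a; case: ifPn => [iN|_]; [exact: is_density_cell m_rho iN|rewrite lexx ler01].
have AB : `|B - A| <= N^-1 * (Num.sqrt 2 + K).
  have -> : B - A = N^-1 * \sum_(0 <= i < n.+1) fourier k (i%:R / N) *
      (a i - (rounding a i)%:R).
    rewrite mulr_sumr -sumrB; apply: eq_big_nat => i /andP[_]; rewrite ltnS => iN.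
    rewrite empirical_cell// ffunE inordK// -/a /a iN.
    by field; rewrite gt_eqF.
  have Ni : 0 < N^-1 :> R by rewrite invr_gt0.
  rewrite normrM (gtr0_norm Ni) ler_pM2l//.
  have := @abel_le R (fun i => fourier k (i%:R / N)) (fun i => a i - (rounding a i)%:R)
    (Num.sqrt 2) (K / N) (rounding_discrepancy a01) _ _ n.+1.
  have -> : n.+1%:R * (K / N) = K by rewrite mulrC divfK// gt_eqF.
  apply=> [i|i]; first exact: fourier_bounded.
  apply: (le_trans (fourier_lipschitz _ _ _)).
  by rewrite -mulrBl -natrB// subSnn mul1r ger0_norm// invr_ge0 ltW.
have -> : N^-1 * (Num.sqrt 2 * (1 + 6 * pi * `|k|%N%:R)) =
    K / N + N^-1 * (Num.sqrt 2 + K) + K / N by rewrite /K; ring.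
rewrite (_ : _ - _ = (pairing m (fourier k) - B) + (B - A) -
    (pairing (empirical R (rounded_config n)) (fourier k) - A)); last by ring.
apply: (le_trans (ler_normB _ _)); apply: lerD => //.
by apply: (le_trans (ler_normD _ _)); apply: lerD.
Qed.

Lemma geometric_sum_le (j : nat) :
  \sum_(0 <= i < j) (3 / 4) ^+ i <= 4 :> R.
Proof.
have -> : \sum_(0 <= i < j) (3 / 4) ^+ i = 4 * (1 - (3 / 4) ^+ j) :> R.
  elim: j => [|j IH]; first by rewrite big_nil expr0 subrr mulr0.
  by rewrite big_nat_recr//= IH exprS; field.
by rewrite -[leRHS]mulr1 ler_wpM2l// lerBlDr lerDl exprn_ge0.
Qed.

Lemma esum_int_geometric_le (C : R) : 0 <= C ->
  (\esum_(k in [set: int]) (C * (3 / 4) ^+ `|k|%N)%:E <= (8 * C)%:E)%E.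
Proof.
move=> C0; have q0 (j : nat) : 0 <= C * (3 / 4) ^+ j by rewrite mulr_ge0// exprn_ge0.
have nat_le : (\esum_(j in [set: nat]) (C * (3 / 4) ^+ j)%:E <= (4 * C)%:E)%E.
  rewrite -nneseries_esumT; last by move=> j; rewrite lee_fin q0.
  apply: lime_le; first by apply: is_cvg_nneseries => j _ _; rewrite lee_fin q0.
  near=> j; rewrite sumEFin lee_fin -mulr_sumr mulrC ler_wpM2r//.
  exact: geometric_sum_le.
rewrite (esumID (range Posz)) => [|k _]; last by rewrite lee_fin q0.
rewrite !setTI (_ : ~` range Posz = range Negz); last first.
  apply/seteqP; split => [[k|k] //= h|_ [k _ <-] /= [j _]//].
    by exfalso; apply: h; exists k.
  by exists k.
rewrite !esum_image => [|i j _ _ []//|i j _ _ []//].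
have -> : (8 * C)%:E = ((4 * C)%:E + (4 * C)%:E)%E :> \bar R.
  by rewrite -EFinD; congr EFin; ring.
apply: leeD; first exact: nat_le.
apply: le_trans nat_le; apply: le_esum => j _ /=.
by rewrite lee_fin exprS mulrCA ler_piMl// ler_pdivrMr// mul1r ler_nat.
Unshelve. all: by end_near.
Qed.

(** Bernoulli's inequality trades the linear growth in the frequency for a
    slower geometric decay, of ratio 3 / 4 instead of 1 / 2. *)
Lemma distM_rounded_le : exists2 C : R, 0 <= C & forall n,
  (distM m (empirical R (rounded_config n)) <= (C / n.+1%:R)%:E)%E.
Proof.
have s0 : 0 <= Num.sqrt 2 :> R by rewrite sqrtr_ge0.
pose D : R := Num.sqrt 2 * (1 + 6 * pi) * 2.
have pi0 : 0 <= pi :> R := pi_ge0 R.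
have D0 : 0 <= D by rewrite !mulr_ge0// addr_ge0// mulr_ge0.
exists (8 * D) => [|n]; first by rewrite mulr_ge0.
set N := n.+1%:R; have N0 : 0 < N :> R by rewrite ltr0n.
rewrite -mulrA; apply: le_trans (esum_int_geometric_le _); last first.
  by rewrite divr_ge0// ltW.
apply: le_esum => k _; rewrite lee_fin; set j := `|k|%N.
apply: (@le_trans _ _ (2 ^- j * (N^-1 * (Num.sqrt 2 * (1 + 6 * pi * j%:R))))).
  by rewrite ler_wpM2l ?invr_ge0 ?exprn_ge0//; exact: pairing_rounded.
have bern : 1 + j%:R / 2 <= (3 / 2) ^+ j :> R.
  elim: {k} j => [|j IH]; first by rewrite mul0r addr0 expr0.
  rewrite exprS; apply: (@le_trans _ _ (3 / 2 * (1 + j%:R / 2))).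
    have := ler0n R j; rewrite mulrSr; lra.
  by rewrite ler_wpM2l.
have -> : (3 / 4) ^+ j = 2 ^- j * (3 / 2) ^+ j :> R.
  by rewrite -exprVn -exprMn; congr (_ ^+ _); field.
have -> : D / N * (2 ^- j * (3 / 2) ^+ j) = 2 ^- j * (N^-1 * (D * (3 / 2) ^+ j)) by ring.
rewrite ler_wpM2l ?invr_ge0 ?exprn_ge0// ler_wpM2l ?invr_ge0 ?(ltW N0)//.
rewrite /D -!mulrA ler_wpM2l//; have j0 := ler0n R j.
have p0 : 0 <= (1 + 6 * pi) * (2 * ((3 / 2) ^+ j - (1 + j%:R / 2))) :> R.
  by rewrite !mulr_ge0 ?subr_ge0// addr_ge0// mulr_ge0.
have p1 : 0 <= pi * j%:R :> R by rewrite mulr_ge0.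
move: p0; lra.
Qed.

(** The bound of [pairing_rounded] grows linearly with the frequency, which the
    geometric weights of the distance absorb: the rounded configurations converge
    to [m] at speed [1 / N], and enter every neighborhood of it. *)
Lemma open_reachable (O : set (Mplus R)) : open O -> O m ->
  \forall n \near \oo, O (empirical R (rounded_config n)).
Proof.
move=> oO Om; have [e /= e0 eO] : exists2 e : R, 0 < e & ball m e `<=` O.
  by move: oO; rewrite openE => /(_ _ Om)/nbhs_ballP.
have [C C0 HC] := distM_rounded_le.
exists (Num.truncn (C / e)) => // n /= Cn; apply: eO.
change (distM m (empirical R (rounded_config n)) < e%:E)%E.
apply: le_lt_trans (HC n) _; rewrite lte_fin ltr_pdivrMr ?ltr0n// mulrC.
by rewrite -ltr_pdivrMr// (lt_le_trans (truncnS_gt _))// ler_nat ltnS.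
Qed.

End approximation.

(** * Irreducibility *)

Section irreducible.
Context {R : realType} (c : (int -> bool) -> R) (c_gt0 : forall x, 0 < c x).
Context {n : nat} {d : measure_display} {Omega : measurableType d}.
Variables (P : config n -> probability Omega R) (X : R -> Omega -> config n).
Hypothesis XP : is_markov_process (@generator R c n) P X.

Lemma flip_neq (x : config n) i : x != flip x i.
Proof. by apply/eqP => /ffunP/(_ i); rewrite ffunE eqxx; case: (x i). Qed.

Lemma generator_flip_gt0 (x : config n) i :
  0 < generator c (fun y => (y == flip x i)%:R) x.
Proof.
rewrite /generator (negbTE (flip_neq x i)) ltr_wpDr//.
  rewrite mulr_ge0 ?divr_ge0 ?exprn_ge0//; apply: sumr_ge0 => j _.
  by rewrite subr0.
rewrite (bigD1 i)//= eqxx subr0 mulr1 ltr_wpDr//; last exact: c_gt0.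
by apply: sumr_ge0 => j _; rewrite subr0 mulr_ge0// ltW// c_gt0.
Qed.

(** The generator is the derivative at time [0], so a positive jump rate makes
    the jump possible at some small time. *)
Lemma transition_flip_gt0 (x : config n) i :
  exists2 t, 0 <= t & 0 < transition P X t x (flip x i).
Proof.
have near0 := cvgr_gt _ (@markov_generator _ _ _ _ _ _ _ XP (fun y => (y == flip x i)%:R) x)
  _ (generator_flip_gt0 x i).
have [t [t0]] : exists t, 0 < t /\
    0 < (\int[P x]_w (X t w == flip x i)%:R - (x == flip x i)%:R) / t.
  have : \forall t \near 0^'+, 0 < t /\
      0 < (\int[P x]_w (X t w == flip x i)%:R - (x == flip x i)%:R) / t.
    by near=> t; split; near: t; [exact: nbhs_right_gt|exact: near0].
  by move/filter_ex.
rewrite (negbTE (flip_neq x i)) subr0 pmulr_lgt0 ?invr_gt0// => int_gt0.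
exists t; first exact: ltW.
move: int_gt0; congr (_ < _).
have mt : measurable (at_time X t [set flip x i]%SET).
  by apply: (measurable_at_time XP); exact: ltW.
rewrite /transition /prob -[X in P x X]setIT -integral_indic//.
apply: eq_Rintegral => w _; rewrite indicE; congr ((nat_of_bool _)%:R).
by apply/idP/idP => [h|/set_mem]; [apply/mem_set|]; rewrite /at_time/= inE.
Unshelve. all: by end_near.
Qed.

Variable mu : config n -> R.
Hypothesis pmu : invariant_proba (transition P X) mu.

Lemma invariant_flip (x : config n) i : 0 < mu x -> 0 < mu (flip x i).
Proof.
move=> x0; have [t t0 xt] := transition_flip_gt0 x i.
rewrite -(invariantE pmu _ t0) (bigD1 x)//= ltr_wpDr ?mulr_gt0//.
by apply: sumr_ge0 => y _; rewrite mulr_ge0 ?(invariant_ge0 pmu)// prob_ge0.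
Qed.

(** Single flips, whose rates are positive, connect all the configurations. *)
Lemma invariant_gt0 (y : config n) : 0 < mu y.
Proof.
have [x x0] : exists x, 0 < mu x.
  apply: contrapT => h; have := invariant_sum1 pmu; rewrite big1.
    by move/eqP; rewrite eq_sym oner_eq0.
  move=> x _; apply/eqP; rewrite eq_le (invariant_ge0 pmu) andbT leNgt.
  by apply/negP => x0; apply: h; exists x.
have [k] := ubnP #|[set i | x i != y i]%SET|.
elim: k => // k IH in x x0 *; rewrite ltnS => xk.
have [xy|[i ixy]] := set_0Vmem [set i | x i != y i]%SET.
  suff -> : y = x by [].
  apply/esym/ffunP => i; move/setP: xy => /(_ i).
  by rewrite !inE => /negbFE/eqP.
apply: (IH (flip x i)); first exact: invariant_flip.
apply: leq_trans xk; apply: proper_card; apply/properP; split.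
  apply/fintype.subsetP => j; rewrite !inE ffunE; have [->|//] := eqVneq j i.
  by move: ixy; rewrite inE => ->.
by exists i => //; move: ixy; rewrite !inE ffunE eqxx negbK; case: (x i) (y i) => [] [].
Qed.

End irreducible.

(** * Nearly exponential killing times *)

Section renewal.
Context {R : realType} {E : finType} {p Q : R -> E -> E -> R} {mu : E -> R}.
Hypotheses (pQ : killed_semigroup p Q) (pmu : invariant_proba p mu).
Local Notation G := (survival Q).
Variables (T e : R).
Hypothesis T_gt0 : 0 < T.
Hypothesis mix : forall (f : E -> R) x, (forall y, 0 <= f y <= 1) ->
  `|\sum_y p T x y * f y - average mu f| <= e.

Definition sampled_survival (j : nat) : R := average mu (G (j%:R * T)).
Local Notation S := sampled_survival.

Let jT_ge0 (j : nat) : 0 <= j%:R * T. Proof. by rewrite mulr_ge0// ltW. Qed.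

Lemma sampled_survival_ge0 j : 0 <= S j.
Proof. exact: (average_survival_ge0 pQ pmu). Qed.

Lemma sampled_survival_cvg (k : nat) (q : R) : q < 1 ->
  (forall x, G (k%:R * T) x <= q) -> cvgn (series S).
Proof.
move=> q1 Gq; apply: (@cvg_series_decay R S _ _ _ k q) => //.
- exact: sampled_survival_ge0.
- exact: (average_survival_le1 pQ pmu).
- move=> i; apply: (average_survival_anti pQ pmu) => //.
  by rewrite ler_pM2r// ler_nat.
- move=> i; rewrite /S natrD mulrDl (average_survival_markov pQ)//.
  rewrite average_survivalE mulr_sumr; apply: ler_sum => y _.
  rewrite mulrC ler_wpM2r//; apply: sumr_ge0 => x _.
  by rewrite mulr_ge0 ?(invariant_ge0 pmu) ?(killed_ge0 pQ).
Qed.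

Hypothesis S_cvg : cvgn (series S).
Local Notation M := (limn (series S)).

(** The two factorization bounds at multiples of [T] are the hypotheses of
    [near_geometric]. *)
Lemma sampled_survival_near_geometric j : 0 < M ->
  `|S j - (M / (M + 1)) ^+ j.+1| <= 2 * (e + M^-1).
Proof.
move=> M0; have step i : i.+1%:R * T = i%:R * T + T by rewrite mulrSr mulrDl mul1r.
apply: near_geometric => //.
- exact: sampled_survival_ge0.
- exact: (average_survival_le1 pQ pmu).
- move=> i i'; rewrite /S natrD mulrDl step [_ + T]addrC.
  exact: (average_survival_mul_le pQ pmu (ltW T_gt0) mix).
- move=> i i'; rewrite /S natrD mulrDl !step [i'%:R * T + T]addrC.
  exact: (average_survival_mul_ge pQ pmu (ltW T_gt0) mix).
Qed.

Lemma series_sampled_ge (b : R) (k : nat) :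
  (forall j, (j < k)%N -> b <= S j) -> k%:R * b <= M.
Proof.
move=> bS; apply: (@le_trans _ _ (series S k)).
  rewrite mulr_natl -[k in leLHS]subn0 -sumr_const_nat /series/=.
  by apply: ler_sum_nat => j /andP[_]; exact: bS.
apply: nondecreasing_cvgn_le => //; apply: nondecreasing_series => j _ _.
exact: sampled_survival_ge0.
Qed.

(** A chain that survives from [z] up to [L] also survives from equilibrium up to
    [L - T], since it may be left to mix first; so about [L / T] terms of the
    series are not small. This makes the mean killing time large in units of [T]. *)
Lemma series_sampled_large (z : E) (L : R) : 0 <= L ->
  e + (1 - G L z) <= 2^-1 -> (L / T - 1) / 2 <= M.
Proof.
move=> L0 small; have LT : 0 <= L / T by rewrite divr_ge0// ltW.
have /andP[lo hi] := truncn_itv LT.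
apply: (@le_trans _ _ ((Num.truncn (L / T))%:R * 2^-1)).
  by rewrite ler_pM2r ?invr_gt0// lerBlDr -mulrSr ltW.
apply: series_sampled_ge => j jL.
have jL' : T + j%:R * T <= L.
  rewrite -[X in X + _]mul1r -mulrDl addrC -mulrSr -ler_pdivlMr//.
  by apply: le_trans lo; rewrite ler_nat.
have := survival_anti pQ z (addr_ge0 (ltW T_gt0) (jT_ge0 j)) jL'.
have := survival_le_average pQ (ltW T_gt0) mix z (jT_ge0 j).
rewrite -/(S j); lra.
Qed.

(** This bound and the next one come from [1 + y <= expR y], at [y = K^-1] and at
    [y = - (K + 1)^-1]. *)
Lemma geometric_ge_expR (K : R) (j : nat) : 0 < K ->
  expR (- (j%:R / K)) <= (K / (K + 1)) ^+ j.
Proof.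
move=> K0; rewrite -mulrN expRM_natl; apply: lerXn2r.
- by rewrite nnegrE expR_ge0.
- by rewrite nnegrE divr_ge0 ?addr_ge0// ltW.
rewrite expRN -[leRHS]invrK lef_pV2 ?posrE ?expR_gt0 ?invr_gt0 ?divr_gt0 ?addr_gt0//.
rewrite invf_div; apply: le_trans (expR_ge1Dx _).
by rewrite mulrDl divff ?gt_eqF// div1r.
Qed.

Lemma geometric_le_expR (K : R) (j : nat) : 0 < K ->
  (K / (K + 1)) ^+ j <= expR (- (j%:R / (K + 1))).
Proof.
move=> K0; have K1 : 0 < K + 1 by rewrite addr_gt0.
rewrite -mulrN expRM_natl; apply: lerXn2r.
- by rewrite nnegrE divr_ge0 ?addr_ge0// ltW.
- by rewrite nnegrE expR_ge0.
apply: le_trans (expR_ge1Dx _); rewrite le_eqVlt; apply/orP; left; apply/eqP.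
by field; rewrite gt_eqF.
Qed.

(** In units of the mean killing time the survival probability is close to
    the exponential one: sandwich the time [m * x] between multiples of [T]. *)
Lemma survival_near_exponential (z : E) (m x : R) : 0 <= e -> 0 < M ->
  T * (M - 1) <= m <= T * M -> 0 <= x -> 0 <= m ->
  expR (- x - M^-1) - (3 * e + 2 * M^-1 + (1 - G T z)) <= G (m * x) z <=
  expR (- x + (2 * x + 1) * M^-1) + (3 * e + 2 * M^-1).
Proof.
move=> e0 M0 /andP[mlo mhi] x0 m0.
have y0 : 0 <= m * x / T by rewrite divr_ge0 ?mulr_ge0// ltW.
have /andP[lo hi] := truncn_itv y0; set j := Num.truncn _ in lo hi.
have M1 : 0 < M + 1 by rewrite addr_gt0.
have xM : m * x / T <= x * M by rewrite ler_pdivrMr// mulrC -mulrA [M * T]mulrC ler_wpM2l.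
have Mx : x * (M - 1) <= m * x / T.
  by rewrite ler_pdivlMr// [m * x]mulrC -mulrA [_ * T]mulrC ler_wpM2l.
have near := sampled_survival_near_geometric ^~ M0.
have jT : j%:R * T <= m * x by rewrite -ler_pdivlMr.
have Tj : m * x <= T + j%:R * T.
  by rewrite -[X in X + _]mul1r -mulrDl addrC -mulrSr -ler_pdivrMr// ltW.
apply/andP; split.
  apply: (@le_trans _ _ (G (T + j%:R * T) z)); last first.
    by apply: (survival_anti pQ) => //; rewrite mulr_ge0.
  apply: le_trans (survival_ge_average pQ (ltW T_gt0) mix z (jT_ge0 j)).
  rewrite -/(S j); have := near j; rewrite ler_norml => /andP[+ _].
  suff : expR (- x - M^-1) <= (M / (M + 1)) ^+ j.+1 by lra.
  apply: le_trans (geometric_ge_expR _ M0); rewrite ler_expR -opprD lerN2.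
  rewrite mulrSr mulrDl div1r lerD2r ler_pdivrMr//.
  exact: le_trans xM.
apply: (@le_trans _ _ (G (j%:R * T) z)); first exact: (survival_anti pQ).
apply: (@le_trans _ _ ((M / (M + 1)) ^+ j + (3 * e + 2 * M^-1))).
  case: (j) => [|i].
    rewrite expr0 (le_trans (survival_le1 pQ _ _)) ?mul0r// lerDl.
    by rewrite addr_ge0// mulr_ge0// invr_ge0 ltW.
  rewrite mulrSr mulrDl mul1r addrC.
  apply: (le_trans (survival_le_average pQ (ltW T_gt0) mix z (jT_ge0 i))).
  rewrite -/(S i); have := near i; rewrite ler_norml => /andP[_]; lra.
rewrite lerD2r; apply: (le_trans (geometric_le_expR _ M0)); rewrite ler_expR.
suff : x - (2 * x + 1) * M^-1 <= j%:R / (M + 1) by lra.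
apply: (@le_trans _ _ (x - (2 * x + 1) / (M + 1))).
  rewrite lerD2l lerN2 ler_wpM2l ?addr_ge0 ?mulr_ge0//.
  by rewrite lef_pV2 ?posrE// lerDl.
rewrite ler_pdivlMr// mulrBl divfK ?gt_eqF//.
move: (le_lt_trans Mx hi); rewrite mulrSr; lra.
Qed.

End renewal.

(** * Hitting times for a fixed number of sites *)

Section fixed_size.
Context {R : realType} {c : (int -> bool) -> R} (c_gt0 : forall x, 0 < c x).
Context {n : nat} {d : measure_display} {Omega : measurableType d}.
Context {P : config n -> probability Omega R} {X : R -> Omega -> config n}.
Hypothesis XP : is_markov_process (@generator R c n) P X.
Context {mu : config n -> R} (mu_stat : stationary P X mu).
Implicit Types (x y z : config n) (A : {set config n}).

Let pmu := invariant_process mu_stat.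

Lemma law_transition x t A : 0 <= t ->
  law P X x t A = \sum_(y in A) transition P X t x y.
Proof.
move=> t0; have := prob_at_time_sum XP x A measurableT t0.
rewrite setTI => E; rewrite [LHS]E.
by apply: eq_bigr => y _; rewrite setTI.
Qed.

(** The distance to equilibrium does not increase with time, and some time before
    [tau] realizes the threshold. *)
Lemma mixing_time_ltP (tau : R) : (mixing_time P X mu 4^-1 < tau%:E)%E ->
  0 <= tau /\ forall x A,
    `|\sum_(y in A) transition P X tau x y - \sum_(y in A) mu y| <= 4^-1.
Proof.
move=> /ereal_inf_lt[_ [t [t0 tmix] <-]]; rewrite lte_fin => ttau.
split=> [|x A]; first exact: le_trans (ltW ttau).
have pQ := killed_semigroup_process XP finset.set0.
have tA y : `|\sum_(z in A) transition P X t y z - \sum_(z in A) mu z| <= 4^-1.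
  rewrite -law_transition//; apply: le_trans tmix.
  apply: le_trans (le_bigmax _ _ y); rewrite /tv_distance.
  exact: (le_bigmax _ (fun B => `|law P X y t B - \sum_(z in B) mu z|) A).
have s0 : 0 <= tau - t by rewrite subr_ge0 ltW.
have -> : \sum_(y in A) transition P X tau x y =
    \sum_z transition P X (tau - t) x z * \sum_(y in A) transition P X t z y.
  under [RHS]eq_bigr do rewrite mulr_sumr.
  rewrite exchange_big/=; apply: eq_bigr => y _.
  by rewrite -(semigroupD pQ)// subrK.
rewrite -[\sum_(y in A) mu y]mul1r -(semigroup_sum1 pQ x s0) mulr_suml -sumrB.
under eq_bigr do rewrite -mulrBr.
apply: (le_trans (ler_norm_sum _ _ _)).
apply: (@le_trans _ _ (\sum_z transition P X (tau - t) x z * 4^-1)); last first.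
  by rewrite -mulr_suml (semigroup_sum1 pQ)// mul1r.
apply: ler_sum => z _; rewrite normrM ger0_norm ?(semigroup_ge0 pQ)//.
by rewrite ler_wpM2l ?(semigroup_ge0 pQ).
Qed.

Variables (O : set (Mplus R)) (x0 : config n) (O_x0 : O (empirical R x0)).
Variables (tau : R) (tau_gt0 : 0 < tau).
Hypothesis tau_mix : (mixing_time P X mu 4^-1 < tau%:E)%E.
Let T : R := n.+1%:R * tau.
Let T_gt0 : 0 < T. Proof. by rewrite mulr_gt0// ltr0n. Qed.
Local Notation Q := (killed_transition P X (outside O)).

Let pQ := killed_semigroup_process XP (outside O).

Let mix (k : nat) (f : config n -> R) x : (forall y, 0 <= f y <= 1) ->
  `|\sum_y transition P X (k%:R * T) x y * f y - average mu f| <= 2^-1 ^+ (k * n.+1).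
Proof.
have [tau0 mix4] := mixing_time_ltP tau_mix.
rewrite /T mulrA -natrM; exact: (mixing_iter pQ pmu).
Qed.

(** The target has positive stationary probability, hence is visited with a
    uniformly positive probability once the chain has mixed. *)
Lemma uniform_hitting : exists k q, q < 1 /\ forall x, survival Q (k%:R * T) x <= q.
Proof.
pose f y : R := (y \in outside O)%:R.
have f01 y : 0 <= f y <= 1 by rewrite ler0n lern1 leq_b1.
have mux0 : 0 < mu x0 := invariant_gt0 c_gt0 XP pmu x0.
have mu_out : average mu f <= 1 - mu x0.
  rewrite -(invariant_sum1 pmu) /average (bigD1 x0)//= [in leRHS](bigD1 x0)//=.
  have -> : f x0 = 0 by rewrite /f inE (asboolT O_x0).
  rewrite mulr0 add0r addrAC subrr add0r; apply: ler_sum => y _.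
  by rewrite ler_piMr ?(invariant_ge0 pmu)//; case/andP: (f01 y).
pose k := (Num.truncn (2 / mu x0)).+1.
have ek : 2^-1 ^+ (k * n.+1) <= mu x0 / 2.
  rewrite exprVn -[leRHS]invrK lef_pV2 ?posrE ?exprn_gt0 ?invr_gt0 ?divr_gt0//.
  rewrite invf_div ltW// (lt_trans (truncnS_gt _))// -natrX ltr_nat.
  by apply: (leq_trans (ltn_expl _ (leqnn 2))); rewrite leq_exp2l// leq_pmulr.
exists k, (1 - mu x0 / 2); split => [|x]; first by rewrite ltrBlDr ltrDl divr_gt0.
have kT0 : 0 <= k%:R * T by rewrite mulr_ge0// ltW.
rewrite (survivalE XP)//.
apply: (@le_trans _ _ (\sum_y transition P X (k%:R * T) x y * f y)); last first.
  by have := mix k x f01; rewrite ler_norml => /andP[_]; lra.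
have <- : prob P x (at_time X (k%:R * T) (outside O)) =
    \sum_y transition P X (k%:R * T) x y * f y.
  transitivity (law P X x (k%:R * T) (outside O)); first by [].
  rewrite law_transition// big_mkcond/=.
  apply: eq_bigr => y _; rewrite /f; case: ifP => _; first by rewrite mulr1.
  by rewrite mulr0.
apply: prob_le.
- exact: (measurable_alive XP).
- exact: (measurable_at_time XP).
- by move=> w; apply; rewrite kT0 add0r lexx.
Qed.

(** The mixing period is [T]: after it the distance to equilibrium is at most
    [2 ^- n.+1]. The time [L] is one before which hitting is unlikely; the smaller
    [T / L], the closer the law to the exponential one. *)
Lemma hitting_time_near_exponential (z : config n) (L : R) :
  3 < L / T ->
  2^-1 ^+ n.+1 + (1 - prob P z (alive X (outside O) 0 L)) <= 2^-1 ->
  exists m K : R, [/\ stationary_mean P mu (hitting_time X O) = m%:E, 0 < m,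
    (L / T - 1) / 2 <= K & forall x : R, 0 <= x ->
    expR (- x - K^-1) - (3 * 2^-1 ^+ n.+1 + 2 * K^-1 +
      (1 - prob P z (alive X (outside O) 0 L))) <=
    prob P z (alive X (outside O) 0 (m * x)) <=
    expR (- x + (2 * x + 1) * K^-1) + (3 * 2^-1 ^+ n.+1 + 2 * K^-1)].
Proof.
move=> LT small.
have TL : T <= L.
  by rewrite -[X in X <= _]mul1r -ler_pdivlMr// (le_trans _ (ltW LT))// ler1n.
have L0 : 0 <= L := le_trans (ltW T_gt0) TL.
have aliveG t : 0 <= t -> prob P z (alive X (outside O) 0 t) = survival Q t z.
  by move=> t0; rewrite (survivalE XP).
have mix1 (f : config n -> R) x : (forall y, 0 <= f y <= 1) ->
    `|\sum_y transition P X T x y * f y - average mu f| <= 2^-1 ^+ n.+1.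
  by move=> f01; have := mix 1 x f01; rewrite mul1r mul1n.
have [k [q [q1 Gq]]] := uniform_hitting.
have S_cvg := sampled_survival_cvg pQ pmu T_gt0 q1 Gq.
have [m [mE mlo mhi]] := stationary_mean_bounds XP T_gt0 mu_stat S_cvg.
set M := limn _ in mlo mhi *.
rewrite !aliveG// in small *.
have ML : (L / T - 1) / 2 <= M by exact: (series_sampled_large pQ pmu T_gt0 mix1 S_cvg L0 small).
(* This is where the ratio must exceed 3: the mean is then positive. *)
have M1 : 1 < M by apply: lt_le_trans ML; lra.
have m0 : 0 < m by apply: lt_le_trans mlo; rewrite mulr_gt0// subr_gt0.
exists m, M; split => // x x0'; rewrite aliveG; last by rewrite mulr_ge0// ltW.
have e0 : 0 <= 2^-1 ^+ n.+1 :> R by rewrite exprn_ge0// invr_ge0.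
have M0 : 0 < M by apply: lt_trans M1.
have mb : T * (M - 1) <= m <= T * M by rewrite mlo mhi.
have /andP[lo ->] := survival_near_exponential pQ pmu T_gt0 mix1 S_cvg z e0 M0 mb x0' (ltW m0).
rewrite andbT; apply: le_trans lo; rewrite lerD2l lerN2 lerD2l lerD2l lerN2.
by apply: (survival_anti pQ) => //; exact: ltW.
Qed.

End fixed_size.

(** * Many sites *)

Lemma exponential_cdf (R : realType) (x : R) : 0 <= x ->
  exponential_prob 1 `]-oo, x]%classic = (1 - expR (- x))%:E.
Proof.
move=> x0; rewrite /exponential_prob.
have -> : `]-oo, x]%classic = `]-oo, 0[%classic `|` `[0, x]%classic.
  apply/seteqP; split => y /=; rewrite !in_itv/=.
    by move=> yx; have [y0|y0] := ltP y 0; [left|right].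
  by case=> [y0|/andP[//]]; rewrite ltW// (lt_le_trans y0).
have mpdf (D : set R) : measurable_fun D (EFin \o exponential_pdf 1).
  by apply/measurable_funTS/measurable_EFinP; exact: measurable_exponential_pdf.
rewrite ge0_integral_setU//=; last 3 first.
- exact: mpdf.
- by move=> y _; rewrite lee_fin exponential_pdf_ge0.
- apply/disj_setPS => y /=; rewrite !in_itv/= => -[y0 /andP[y0' _]].
  by move: (lt_le_trans y0 y0'); rewrite ltxx.
rewrite integral0_eq ?add0e; last first.
  move=> y; rewrite /= in_itv/= => y0.
  by rewrite /exponential_pdf patchE memNset//= in_itv/= andbT; apply/negP; rewrite -ltNge.
move: x0; rewrite le_eqVlt => /predU1P[<-|x0].
  by rewrite set_itv1 integral_set1 oppr0 expR0 subrr.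
by have := exponential_prob_itv0c 1 x0; rewrite /exponential_prob mulN1r => ->.
Qed.

Lemma exponential_cdf_lt0 (R : realType) (x : R) : x < 0 ->
  exponential_prob 1 `]-oo, x]%classic = 0%E.
Proof.
move=> x0; rewrite /exponential_prob integral0_eq// => y; rewrite /= in_itv/= => yx.
by rewrite /exponential_pdf patchE memNset//= in_itv/= andbT; apply/negP; rewrite -ltNge (le_lt_trans yx).
Qed.

(** The previous estimate, read on the hitting time divided by its stationary
    mean. The errors involve only three quantities that the asymptotics controls:
    the mixing error [e], the probability [a] of an early hit and the ratio
    [T / L]. *)
Lemma hitting_cdf_near (R : realType) (c : (int -> bool) -> R) (n : nat)
  (d : measure_display) (Omega : measurableType d)
  (P : config n -> probability Omega R) (X : R -> Omega -> config n)
  (mu : config n -> R) (O : set (Mplus R)) (x0 z : config n) (tau L : R) :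
  (forall x, 0 < c x) -> is_markov_process (@generator R c n) P X ->
  stationary P X mu -> O (empirical R x0) -> 0 < tau ->
  (mixing_time P X mu 4^-1 < tau%:E)%E ->
  let T := n.+1%:R * tau in
  let e := 2^-1 ^+ n.+1 in
  let a := fine (P z [set w | (hitting_time X O w <= L%:E)%E]) in
  let v := 2 / (L / T - 1) in
  let cdf x := P z [set w |
    (hitting_time X O w / stationary_mean P mu (hitting_time X O) <= x%:E)%E] in
  3 < L / T -> e + a <= 2^-1 ->
  (forall x, x < 0 -> cdf x = 0%E) /\
  (forall x, 0 <= x -> cdf x \is a fin_num /\
    1 - (expR (- x + (2 * x + 1) * v) + (3 * e + 2 * v)) <= fine (cdf x) <=
    1 - (expR (- x - v) - (3 * e + 2 * v + a))).
Proof.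
move=> c0 XP mu_stat Ox0 tau0 mix T e a v cdf LT small.
have T0 : 0 < T by rewrite mulr_gt0.
have L0 : 0 <= L.
  rewrite leNgt; apply/negP => L0; have : L / T < 0 by rewrite pmulr_llt0 ?invr_gt0.
  lra.
have leE t : 0 <= t -> fine (P z [set w | (hitting_time X O w <= t%:E)%E]) =
    1 - prob P z (alive X (outside O) 0 t).
  move=> t0; have mA := measurable_alive XP (outside O) (lexx 0) t0.
  by rewrite (hitting_time_le XP)// probability_setC// (probE P z mA).
have [m [K [mE m0 vK main]]] : exists m K : R, [/\
    stationary_mean P mu (hitting_time X O) = m%:E, 0 < m,
    (L / T - 1) / 2 <= K & forall x : R, 0 <= x ->
    expR (- x - K^-1) - (3 * e + 2 * K^-1 + a) <=
    prob P z (alive X (outside O) 0 (m * x)) <=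
    expR (- x + (2 * x + 1) * K^-1) + (3 * e + 2 * K^-1)].
  rewrite /a leE//; apply: (hitting_time_near_exponential c0 XP mu_stat Ox0 tau0 mix) => //.
  by rewrite -leE.
have r0 : 0 < (L / T - 1) / 2 by rewrite divr_gt0// subr_gt0; lra.
have Kv : K^-1 <= v.
  by rewrite /v -[leRHS]invf_div lef_pV2 ?posrE// (lt_le_trans r0 vK).
have cdfE x : cdf x = P z [set w | (hitting_time X O w <= (m * x)%:E)%E].
  rewrite /cdf mE; congr (P z _); apply/seteqP; split => w /=;
  by rewrite inver gt_eqF// lee_pdivrMr// -EFinM mulrC.
split => x x0'.
  rewrite cdfE (_ : mkset _ = set0) ?measure0//; apply/seteqP; split => w //=.
  apply/negP; rewrite -ltNge (lt_le_trans _ (hitting_time_ge0 X O w))// lte_fin.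
  by rewrite pmulr_rlt0.
have mx : 0 <= m * x by rewrite mulr_ge0// ltW.
rewrite cdfE; split.
  rewrite fin_num_measure// (hitting_time_le XP)//.
  by apply: measurableC; exact: (measurable_alive XP).
rewrite leE//.
have /andP[lo hi] := main x x0'.
have E1 : expR (- x - v) <= expR (- x - K^-1) by rewrite ler_expR lerD2l lerN2.
have E2 : expR (- x + (2 * x + 1) * K^-1) <= expR (- x + (2 * x + 1) * v).
  by rewrite ler_expR lerD2l ler_wpM2l// addr_ge0// mulr_ge0.
by apply/andP; split; move: lo hi E1 E2 Kv; lra.
Qed.

(** A single term of the exponential series, of degree one more than the power,
    is enough. *)
Lemma expR_div_pow_large (R : realType) (h : R) (k : nat) : 0 < h ->
  forall A : R, \forall n \near \oo,
    A < expR (n.+1%:R * h) / (n.+1%:R * n.+1%:R ^+ k).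
Proof.
move=> h0 A; set C : R := h ^+ k.+2 / k.+2`!%:R.
have C0 : 0 < C by rewrite divr_gt0 ?exprn_gt0// ltr0n fact_gt0.
near=> n; have N0 : 0 < n.+1%:R :> R by rewrite ltr0n.
rewrite -exprS ltr_pdivlMr ?exprn_gt0//.
have := @expR_ge1Dxn R (n.+1%:R * h) k.+1 (mulr_ge0 (ltW N0) (ltW h0)).
apply: lt_le_trans; rewrite -[ltLHS]add0r ltr_leD// exprMn -mulrA -/C.
rewrite [_ ^+ k.+2]exprS [leRHS]mulrAC ler_wpM2r ?exprn_ge0// -ler_pdivrMr//.
apply: (@le_trans _ _ n%:R); last by rewrite ler_nat.
by rewrite ltW//; near: n; exact: nbhs_infty_gtr.
Unshelve. all: by end_near.
Qed.

Theorem theorem4p3 (R : realType)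
  (c : (int -> bool) -> R) (r : nat)
  (c_gt0 : forall eta, 0 < c eta) (c_local : local_function r c)
  (d : nat -> measure_display) (Omega : forall n, measurableType (d n))
  (P : forall n, config n -> probability (Omega n) R)
  (X : forall n, R -> Omega n -> config n)
  (X_markov : forall n, is_markov_process (@generator R c n) (P n) (@X n))
  (mu : forall n, config n -> R)
  (mu_stationary : forall n, stationary (P n) (@X n) (mu n))
  (V : R -> R) (V_potential : is_potential r c V) (rho : {i01 R})
  (UM : local_min01 V rho%:num /\ forall x, local_min01 V x -> x = rho%:num)
  (MT : exists2 a : R, 0 < a &
    (mixing_time (P n) (@X n) (mu n) 4^-1 / (n.+1%:R `^ a)%:E)%E
      @[n --> \oo] --> 0%E)
  (SLDP : static_LDP mu (quasi_potential r c (fun=> rho%:num)))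
  (O : set (Mplus R)) (O_open : open O) (O_density : O `&` @Mplus1 R !=set0)
  (O_far : (0 < dist_to_set (Mconst rho) O)%E)
  (h : \bar R)
  (hE : h = half_exit_cost (quasi_potential r c (fun=> rho%:num))
              (Mconst rho) (dist_to_set (Mconst rho) O))
  (h_gt0 : (0 < h)%E)
  (alpha : R) (alpha_gt0 : 0 < alpha)
  (alpha_lt : (alpha%:E < dist_to_set (Mconst rho) O)%E)
  (alphaP :
    \big[maxe/0%E]_(eta : config n | `[< ball (Mconst rho) alpha (empirical R eta) >])
      P n eta [set w | (hitting_time (@X n) O w <= expeR (n.+1%:R%:E * h))%E]
    @[n --> \oo] --> 0%E)
  (eta : forall n, config n)
  (eta_in : \forall n \near \oo, ball (Mconst rho) alpha (empirical R (eta n))) :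
  cvg_in_distribution (fun n => P n (eta n))
    (fun n w => (hitting_time (@X n) O w /
                 stationary_mean (P n) (mu n) (hitting_time (@X n) O))%E)
    (exponential_prob 1).
Proof.
have [a a0 {}MT] := MT.
pose E (n : nat) := (n.+1%:R%:E * h)%E.
pose bad n := P n (eta n) [set w | (hitting_time (@X n) O w <= expeR (E n))%E].
have /fine_cvgP[worst_fin worst0] := alphaP.
have bad_le : \forall n \near \oo, (bad n <= \big[maxe/0%E]_(x : config n |
    `[< ball (Mconst rho) alpha (empirical R x) >])
    P n x [set w | (hitting_time (@X n) O w <= expeR (E n))%E])%E.
  near=> n; apply: le_bigmax_cond; apply/asboolP.
  by near: n; exact: eta_in.
have bad_small (e : R) : 0 < e -> \forall n \near \oo, (bad n < e%:E)%E.
  move=> e0; have := cvgr_lt _ worst0 _ e0 => worst_lt.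
  near=> n; apply: (@le_lt_trans _ _ _ _ _ (near bad_le n _)) => //.
  rewrite -[ltLHS]fineK ?lte_fin; first by near: n; exact: worst_lt.
  by near: n; exact: worst_fin.
have [h0 hE0 h0_gt0] : exists2 h0 : R, h = h0%:E & 0 < h0.
  case: h h_gt0 @E @bad bad_small {hE alphaP worst_fin worst0 bad_le}
    => [h0 h0_gt0 _ _ _|_ E bad bad_small|//]; first by exists h0.
  (* An infinite cost would make the target unreachable at all times. *)
  have /filter_ex[n] := bad_small 1 ltr01.
  rewrite /bad /E gt0_muley ?lte_fin//= (_ : mkset _ = setT) ?probability_setT ?ltxx//.
  by apply/seteqP; split => w //= _; rewrite leey.
(* An integer exponent above [a], for which the mixing bound is weaker. *)
pose k := (Num.truncn a).+1.
pose tau (n : nat) : R := n.+1%:R ^+ k.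
pose L (n : nat) : R := expR (n.+1%:R * h0).
pose ratio n : R := L n / (n.+1%:R * tau n).
have ratio_large A : \forall n \near \oo, A < ratio n := expR_div_pow_large k h0_gt0 A.
have tau_mix : \forall n \near \oo, (mixing_time (P n) (@X n) (mu n) 4^-1 < (tau n)%:E)%E.
  have /fine_cvgP[mix_fin mix0] := MT.
  have mix1 := cvgr_lt _ mix0 _ ltr01.
  near=> n.
  have Na : 0 < n.+1%:R `^ a :> R by rewrite powR_gt0.
  have : (mixing_time (P n) (@X n) (mu n) 4^-1 / (n.+1%:R `^ a)%:E < 1%:E)%E.
    rewrite -[ltLHS]fineK ?lte_fin; first by near: n; exact: mix1.
    by near: n; exact: mix_fin.
  rewrite inver gt_eqF// lte_pdivrMr// mul1e => /lt_le_trans; apply.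
  rewrite lee_fin /tau -powR_mulrn// ler_powR ?ler1n//.
  by rewrite ltW// truncnS_gt.
have reach : \forall n \near \oo, exists x, O (empirical R (x : config n)).
  have [m [Om [g mg]]] := O_density.
  near=> n; exists (rounded_config m n).
  by near: n; exact: (open_reachable mg).
pose e n : R := 2^-1 ^+ n.+1.
pose b n : R := fine (bad n).
pose v n : R := 2 / (ratio n - 1).
have badE n : bad n = P n (eta n) [set w | (hitting_time (@X n) O w <= (L n)%:E)%E].
  by rewrite /bad /E hE0.
have e0 : e n @[n --> \oo] --> 0.
  have : (2^-1 : R) ^+ n @[n --> \oo] --> 0.
    by apply: cvg_expr; rewrite ger0_norm ?invr_ge0// invf_lt1 ?ltr1n.
  by rewrite -(cvg_shiftS (fun n => (2^-1 : R) ^+ n)).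
have b0 : b n @[n --> \oo] --> 0.
  apply/cvgr0Pnorm_lt => s s0; apply: filterS (bad_small s s0) => n bads.
  rewrite ger0_norm ?fine_ge0// -lte_fin fineK//.
  by rewrite ge0_fin_numE// (lt_trans bads)// ltry.
have v0 : v n @[n --> \oo] --> 0.
  apply/cvgr0Pnorm_lt => s s0; apply: filterS (ratio_large (2 / s + 1)) => n big.
  have big' : 2 / s < ratio n - 1 by rewrite ltrBrDr.
  have r0 : 0 < ratio n - 1 by apply: lt_trans big'; rewrite divr_gt0.
  by rewrite ger0_norm ?divr_ge0 ?ltW// ltr_pdivrMr// mulrC -ltr_pdivrMr.
have scale0 (s : R) (w : nat -> R) :
    w n @[n --> \oo] --> 0 -> s * w n @[n --> \oo] --> 0.
  by move=> w0; have := cvgM (cvg_cst s) w0; rewrite mulr0; exact.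
have ev0 : 3 * e n + 2 * v n @[n --> \oo] --> 0.
  by have := cvgD (scale0 3 _ e0) (scale0 2 _ v0); rewrite addr0; exact.
have evb0 : 3 * e n + 2 * v n + b n @[n --> \oo] --> 0.
  by have := cvgD ev0 b0; rewrite addr0; exact.
have cvg_expR_near (y : R) (w : nat -> R) : w n @[n --> \oo] --> 0 ->
    expR (y + w n) @[n --> \oo] --> expR y.
  move=> w0; apply: cvg_comp; last exact: continuous_expR.
  by have := cvgD (cvg_cst y) w0; rewrite addr0; exact.
move=> x _.
have near_cdf : \forall n \near \oo,
    (forall x, x < 0 -> P n (eta n) [set w | (hitting_time (@X n) O w /
      stationary_mean (P n) (mu n) (hitting_time (@X n) O) <= x%:E)%E] = 0%E) /\
    (forall x, 0 <= x -> P n (eta n) [set w | (hitting_time (@X n) O w /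
      stationary_mean (P n) (mu n) (hitting_time (@X n) O) <= x%:E)%E] \is a fin_num /\
      1 - (expR (- x + (2 * x + 1) * v n) + (3 * e n + 2 * v n)) <=
      fine (P n (eta n) [set w | (hitting_time (@X n) O w /
        stationary_mean (P n) (mu n) (hitting_time (@X n) O) <= x%:E)%E]) <=
      1 - (expR (- x - v n) - (3 * e n + 2 * v n + b n))).
  near=> n.
  have [x0 Ox0] : exists x, O (empirical R (x : config n)) by near: n; exact: reach.
  rewrite /b badE; apply: (hitting_cdf_near c_gt0 (X_markov n) (mu_stationary n) Ox0).
  - by rewrite exprn_gt0.
  - by near: n; exact: tau_mix.
  - by near: n; exact: ratio_large.
  - rewrite -badE -/(b n) -/(e n); near: n.
    by have := cvgr_le _ (cvgD e0 b0) 2^-1; rewrite addr0; apply; rewrite invr_gt0.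
have [x0|x0] := ltP x 0.
  rewrite exponential_cdf_lt0//; apply: cvg_near_cst.
  by apply: filterS near_cdf => n [cdf0 _]; exact: cdf0.
rewrite exponential_cdf//; apply/fine_cvgP; split.
  by apply: filterS near_cdf => n [_ cdf_near]; exact: (cdf_near x x0).1.
apply: (squeeze_cvgr (f := fun n => 1 - (expR (- x + (2 * x + 1) * v n) + (3 * e n + 2 * v n)))
   (h := fun n => 1 - (expR (- x - v n) - (3 * e n + 2 * v n + b n)))).
- by apply: filterS near_cdf => n [_ cdf_near]; exact: (cdf_near x x0).2.
- rewrite -[in X in _ --> X](addr0 (expR (- x))).
  apply: cvgB; [exact: cvg_cst|apply: cvgD => //].
  by apply: cvg_expR_near; exact: scale0.
- rewrite -[in X in _ --> X](subr0 (expR (- x))).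
  apply: cvgB; [exact: cvg_cst|apply: cvgB => //].
  by apply: cvg_expR_near; rewrite -[in X in _ --> X]oppr0; exact: cvgN.
Unshelve. all: by end_near.
Qed.
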